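(* With $P(m)$ the universal negative-type exponent of $m$-point Ptolemaic metrics and $q(n)=q(U_{2,n})$ the triangular-hyperfield threshold of the rank-two uniform matroid on $n$ elements (both defined in the context), one has \[ P(5)=\log_2\tfrac94,\qquad P(6)=1. \] Equivalently, \[ q(6)=\log_2\tfrac94,\qquad q(7)=1. \] Thus for $n=6$ and $n=7$ the following formula holds: $q(n)=2\log_2\frac{n}{n-2}$ if $n$ is even, and $q(n)=\log_2\frac{n+1}{n-3}$ if $n$ is odd.
   Context: A metric space $(X,d)$ is Ptolemaic if $d(x,y)d(z,w)\le d(x,z)d(y,w)+d(x,w)d(y,z)$ for all $x,y,z,w\in X$. A finite metric space $(X,d)$ has $q$-negative type if $\sum_{x,y\in X}z_xz_y\,d(x,y)^q\le 0$ for every real vector $(z_x)_{x\in X}$ with $\sum_x z_x=0$. For $m\ge 3$, \[ P(m)=\sup\{q>0:\text{ every Ptolemaic metric on exactly } m \text{ points has } q\text{-negative type}\}. \] For a matroid $M$, $q(M)=\sup\{q>0:\operatorname{Gr}^{\mathrm w}_M(\mathbb T_q)\subseteq \mathbb P\mathrm L_M\}$, and $q(n)=q(U_{2,n})$. Here $\mathbb T_q$ is the triangular hyperfield on $\mathbb R_{\ge0}$ with usual multiplication, in which $0$ lies in the hypersum of $a,b,c$ if and only if each of $a^{1/q},b^{1/q},c^{1/q}$ is at most the sum of the other two; $\operatorname{Gr}^{\mathrm w}_M(\mathbb T_q)$ is the set of weak $\mathbb T_q$-representations of $M$ (functions supported on the bases of $M$ satisfying the three-term Plücker relations over $\mathbb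 T_q$) modulo positive scaling; $\mathbb P\mathrm L_M$ is the set of Lorentzian polynomials whose support is the set of bases of $M$, modulo positive scaling. Concretely, for $M=U_{2,n}$: an element of $\operatorname{Gr}^{\mathrm w}_M(\mathbb T_q)$ is given by positive numbers $p_{ij}=p_{ji}$ $(1\le i<j\le n)$ such that for all distinct $i,j,k,l$ \[ (p_{ij}p_{kl})^{1/q}\le (p_{ik}p_{jl})^{1/q}+(p_{il}p_{jk})^{1/q}, \] and it lies in $\mathbb P\mathrm L_M$ if and only if $\sum_{i<j}p_{ij}x_ix_j$ is Lorentzian, i.e. the symmetric $n\times n$ matrix with zero diagonal and off-diagonal entries $p_{ij}$ has exactly one positive eigenvalue. *)

(* Defs.v *)
From mathcomp Require Import all_boot all_order all_algebra.
From mathcomp Require Import boolp classical_sets reals constructive_ereal ereal.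
From mathcomp Require Import exp.
(* The notations of [mpoly] clash with those of MathComp-Analysis; its
   structure instances are still needed. *)
From mathcomp Require Import -(notations) mpoly.

Set Implicit Arguments.
Unset Strict Implicit.
Unset Printing Implicit Defensive.

Import Order.TTheory GRing.Theory Num.Theory.
Local Open Scope ring_scope.

Definition log2 (R : realType) (x : R) : R := ln x / ln 2.

Section PtolemaicMetrics.
Variable R : realType.

Record is_metric (X : finType) (d : X -> X -> R) : Prop := IsMetric {
  metric_ge0 : forall x y, 0 <= d x y;
  metric_eq0 : forall x y, d x y = 0 <-> x = y;
  metric_sym : forall x y, d x y = d y x;
  metric_triangle : forall x y z, d x z <= d x y + d y z
}.

Definition ptolemaic (X : finType) (d : X -> X -> R) : Prop :=
  forall x y z w, d x y * d z w <= d x z * d y w + d x w * d y z.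

Definition negative_type (X : finType) (q : R) (d : X -> X -> R) : Prop :=
  forall c : X -> R, \sum_x c x = 0 ->
    \sum_x \sum_y c x * c y * d x y `^ q <= 0.

(* The suprema are taken in the extended reals, so that they are meaningful
   without assuming the sets nonempty or bounded. *)
Definition ptolemaic_exponent (m : nat) : \bar R :=
  ereal_sup [set q%:E | q in [set q : R | 0 < q /\
    forall d : 'I_m -> 'I_m -> R,
      is_metric d -> ptolemaic d -> negative_type q d]]%classic.

End PtolemaicMetrics.

Record matroid (n : nat) := Matroid {
  bases : {set {set 'I_n}};
  bases_nonempty : exists B, B \in bases;
  bases_exchange : forall A B x, A \in bases -> B \in bases -> x \in A :\: B ->
    exists2 y, y \in B :\: A & (y |: A :\ x) \in bases
}.

Definition matroid_rank n (M : matroid n) : nat := \max_(B in bases M) #|B|.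

Section Uniform.
Variables r n : nat.

Definition uniform_bases : {set {set 'I_n}} := [set B : {set 'I_n} | #|B| == minn r n].

Lemma uniform_bases_nonempty : exists B, B \in uniform_bases.
Proof.
have /set0Pn[B] : [set B : {set 'I_n} | #|B| == minn r n] != finset.set0.
  by rewrite -card_gt0 card_draws card_ord bin_gt0 geq_minr.
by exists B.
Qed.

Lemma uniform_bases_exchange A B x :
  A \in uniform_bases -> B \in uniform_bases -> x \in A :\: B ->
  exists2 y, y \in B :\: A & (y |: A :\ x) \in uniform_bases.
Proof.
rewrite !inE => /eqP cA /eqP cB /andP[xB xA].
have /card_gt0P[y yBA] : (0 < #|B :\: A|)%N.
  have -> : #|B :\: A| = #|A :\: B| by rewrite !cardsD cA cB finset.setIC.
  by apply/card_gt0P; exists x; rewrite inE xB xA.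
exists y => //; move: yBA; rewrite !inE => /andP[yA yB].
by rewrite cardsU1 !inE (negPf yA) andbF /= -cA [#|A|](cardsD1 x) xA.
Qed.

(* U_{r,n} for r <= n; the truncation [minn r n] only serves to make this a
   matroid for all r and n. *)
Definition uniform : matroid n :=
  Matroid uniform_bases_nonempty uniform_bases_exchange.

End Uniform.

(* The triangular hyperfield T_q on the nonnegative reals: [T_null q a b c]
   says that 0 lies in the hypersum of a, b and c.  Note that -1 = 1 in T_q. *)
Definition T_null (R : realType) (q a b c : R) : Prop :=
  let rt x := x `^ q^-1 in
  [/\ rt a <= rt b + rt c, rt b <= rt a + rt c & rt c <= rt a + rt b].

(* As -1 = 1 in T_q, the alternating functions on r-tuples that represent M are
   symmetric and vanish on tuples with repetitions: they are functions on
   r-subsets, extended here by 0 to all subsets. *)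
Record weak_representation (R : realType) (q : R) n (M : matroid n)
    (p : {set 'I_n} -> R) : Prop := WeakRepresentation {
  weak_rep_ge0 : forall B, 0 <= p B;
  weak_rep_support : forall B, (p B != 0) = (B \in bases M);
  weak_rep_plucker : forall (S : {set 'I_n}) (i j k l : 'I_n),
    #|S|.+2 = matroid_rank M ->
    uniq [:: i; j; k; l] -> [disjoint S & [:: i; j; k; l]] ->
    T_null q (p (i |: (j |: S)) * p (k |: (l |: S)))
             (p (i |: (k |: S)) * p (j |: (l |: S)))
             (p (i |: (l |: S)) * p (j |: (k |: S)))
}.

Section Lorentzian.
Variables (R : realType) (n : nat).
Implicit Types (f g : mpoly n R).

(* Eigenvalues are counted with algebraic multiplicity; for the real symmetric
   matrices considered below the characteristic polynomial always splits. *)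
Definition at_most_one_positive_eigenvalue (A : 'M[R]_n) : Prop :=
  exists2 s : seq R, char_poly A = \prod_(a <- s) ('X - a%:P)
    & (count (fun a : R => (0 < a)%R) s <= 1)%N.

(* For [f] quadratic the second derivatives are constant polynomials. *)
Definition hessian f : 'M[R]_n :=
  \matrix_(i, j) mcoeff mnm0 (mderiv i (mderiv j f)).

Definition M_convex (J : multinom n -> Prop) : Prop :=
  forall a b, J a -> J b -> forall i : 'I_n, (b i < a i)%N ->
    exists2 j : 'I_n, (a j < b j)%N & J (mnm_add (mnm_sub a (mnm1 i)) (mnm1 j)).

(* Braenden-Huh: [f] is homogeneous of degree [deg] with nonnegative
   coefficients and M-convex support, and the quadratic forms obtained by
   differentiating it [deg - 2] times have at most one positive eigenvalue. *)
Definition lorentzian f : Prop :=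
  exists deg : nat,
  [/\ forall a, a \in msupp f -> mdeg a = deg,
      forall a, 0 <= mcoeff a f,
      M_convex (fun a => a \in msupp f)
    & forall a, (mdeg a).+2 = deg ->
        at_most_one_positive_eigenvalue (hessian (mderivm a f))].

(* [mesym1 B] is the exponent of the squarefree monomial of [B]. *)
Definition bases_poly (M : matroid n) (p : {set 'I_n} -> R) : mpoly n R :=
  \sum_(B in bases M) p B *: mpolyX R (mesym1 B).

Definition supported_on_bases (M : matroid n) f : Prop :=
  msupp f =i [seq mesym1 B | B in bases M].

Definition ray f : set (mpoly n R) := [set c *: f | c in [set c : R | 0 < c]]%classic.

(* The set of lines of weak representations, each function on the bases being
   identified with its basis generating polynomial. *)
Definition Gr_weak (q : R) (M : matroid n) : set (set (mpoly n R)) :=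
  [set ray (bases_poly M p) | p in weak_representation q M]%classic.

Definition PL (M : matroid n) : set (set (mpoly n R)) :=
  [set ray f | f in [set f | lorentzian f /\ supported_on_bases M f]]%classic.

Definition matroid_threshold (M : matroid n) : \bar R :=
  ereal_sup [set q%:E | q in [set q : R | 0 < q /\ (Gr_weak q M `<=` PL M)]]%classic.

End Lorentzian.

Definition uniform_threshold (R : realType) (n : nat) : \bar R :=
  matroid_threshold R (uniform 2 n).

(* Main.v *)
(* Sending a point to infinity turns both statements into one about a symmetric
   array P with zero diagonal and positive entries p_ij off the diagonal, whose
   q-th roots satisfy Ptolemy's inequality: the quadratic form of P is to be
   nonpositive on the hyperplane given by the row of one point z.  From
     (s + u)^q <= s^q + u^q + (2^q - 2) (s u)^(q/2)    (1 <= q <= 2)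
   the entries satisfy
     p_ij p_kl <= p_ik p_jl + p_il p_jk + e sqrt (p_ik p_jl p_il p_jk)
   with e = 2^q - 2, which is 1/4 for q = log2 (9/4) and 0 for q = 1.

   For three points A, the matrix P_AA is Lorentzian, and an outer point k gives
   a triangle with angles at most 2 pi / 3 whose squared sides are the products
   p_jm p_ik, where {i, j, m} = A.  For two outer points k and l, the upper bound
   on p_kl coming from one pair in A implies that the entry (k, l) of the Schur
   complement M = P_BA P_AA^-1 P_AB - P_BB is at least - c sqrt (M_kk M_ll) as
   soon as the angles alpha, beta of the two triangles opposite that pair satisfy
     2 c sin alpha sin beta - 2 cos alpha cos beta >= e.
   The left-hand side is - (1 - c) cos (alpha - beta) - (1 + c) cos (alpha + beta),
   and since the six angles sum to 2 pi, some pair has cos (alpha + beta) <= -1/2;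
   so e <= (3 c - 1) / 2 suffices.  If B has at most 1 + 1/c points, M is then
   nonnegative on nonnegative vectors.  For c = 1/2 this covers three outer points
   and e = 1/4, for c = 1/3 four outer points and e = 0.

   If at most two coordinates other than z are positive, A consists of them and
   of z, and one completes the square.  The only other case, up to sign, is three
   positive and three negative coordinates: adding z with a suitable weight to
   one of the two sides reduces it to the reverse Cauchy-Schwarz inequality. *)

Require Import Defs.
From mathcomp Require Import all_boot all_order all_algebra.
From mathcomp Require Import reals constructive_ereal.
From mathcomp Require functions topology normedtype sequences derive realfun.
From mathcomp Require complex.
From mathcomp Require Import ereal exp trigo ring lra zify.
From mathcomp Require Import -(notations) mpoly.
Import Order.TTheory GRing.Theory Num.Theory.
Local Open Scope ring_scope.

Set Implicit Arguments.
Unset Strict Implicit.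
Unset Printing Implicit Defensive.

(** * Two triangles *)

Section Triangles.
Variable R : realType.
Implicit Types (a b c e x y : R).

(* Sixteen times the squared area of the triangle with sides [Num.sqrt x1],
   [Num.sqrt x2] and [Num.sqrt x3]; [pedoe] is its polarization, the
   Neuberg-Pedoe form of two triangles. *)
Definition heron x1 x2 x3 : R :=
  2 * (x1 * x2 + x2 * x3 + x3 * x1) - (x1 ^+ 2 + x2 ^+ 2 + x3 ^+ 2).

Definition pedoe x1 x2 x3 y1 y2 y3 : R :=
  (x1 + x2 + x3) * (y1 + y2 + y3) - 2 * (x1 * y1 + x2 * y2 + x3 * y3).

Lemma cos_sum_pi x1 x2 x3 : x1 + x2 + x3 = pi ->
  cos x1 ^+ 2 + cos x2 ^+ 2 + cos x3 ^+ 2 + 2 * cos x1 * cos x2 * cos x3 = 1.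
Proof.
move=> h; have -> : x3 = pi - (x1 + x2) by rewrite -h; ring.
rewrite cosB cospi sinpi mul0r addr0 cosD.
have h2 := sin2cos2 x2; have h1 := sin2cos2 x1.
set c1 := cos x1 in h1 *; set c2 := cos x2 in h2 *.
set s1 := sin x1 in h1 *; set s2 := sin x2 in h2 *.
have -> : c1 ^+ 2 + c2 ^+ 2 + (-1 * (c1 * c2 - s1 * s2)) ^+ 2 +
  2 * c1 * c2 * (-1 * (c1 * c2 - s1 * s2)) =
  c1 ^+ 2 + c2 ^+ 2 - c1 ^+ 2 * c2 ^+ 2 + s1 ^+ 2 * s2 ^+ 2 by ring.
rewrite h1 h2; ring.
Qed.

(** Three cosines above 1/2 would make the left side of [cos_sum_pi] exceed 3/4 + 1/4. *)
Lemma exists_cos_le_half x1 x2 x3 : x1 + x2 + x3 = pi ->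
  [\/ cos x1 <= 1 / 2, cos x2 <= 1 / 2 | cos x3 <= 1 / 2].
Proof.
move=> /cos_sum_pi.
case: (leP (cos x1) (1 / 2)) => [?|h1]; first by constructor 1.
case: (leP (cos x2) (1 / 2)) => [?|h2]; first by constructor 2.
case: (leP (cos x3) (1 / 2)) => [?|h3]; first by constructor 3.
move: h1 h2 h3; set c1 := cos x1; set c2 := cos x2; set c3 := cos x3.
move=> h1 h2 h3.
have : 1 / 4 < c1 * c2 by nra.
move=> ?; have : 1 / 8 < c1 * c2 * c3 by nra.
nra.
Qed.

Lemma cos_half_ge x y c : 0 <= x <= pi -> 0 <= y <= pi ->
  c <= cos x -> c <= cos y -> c <= cos ((x + y) / 2).
Proof.
wlog xy : x y / x <= y => [hw|] hx hy cx cy.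
  by case: (leP x y) => [/hw|/ltW /hw]; [|rewrite (addrC x)]; apply.
apply: (le_trans cy).
case: (ltgtP ((x + y) / 2) y) => [h||->//]; last by lra.
by apply/ltW; rewrite ltr_cos // in_itv /=; lra.
Qed.

Lemma cos_eqN1 x : 0 < x < 3 * pi -> cos x = -1 -> x = pi.
Proof.
move=> hx cx; have pi0 := pi_gt0 R.
case: (leP x (2 * pi)) => h.
  have : cos `|x - pi| = cos 0.
    by rewrite cos_norm cosB cospi sinpi mulr0 addr0 cx cos0; ring.
  move/cos_inj; rewrite !in_itv /= normr_ge0 lexx (ltW pi0) ler_norml.
  have -> : - pi <= x - pi <= pi by lra.
  by move=> /(_ isT isT) /eqP; rewrite normr_eq0 subr_eq0 => /eqP.
have : cos (x - pi *+ 2) = cos pi.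
  by rewrite cosB cos2pi sin2pi mulr0 addr0 mulr1 cx cospi.
by move/cos_inj; rewrite !in_itv /= => H; have := H ltac:(lra) ltac:(lra); lra.
Qed.


Lemma heron_factor a1 a2 a3 : heron (a1 ^+ 2) (a2 ^+ 2) (a3 ^+ 2) =
  (a1 + a2 + a3) * (a2 + a3 - a1) * (a3 + a1 - a2) * (a1 + a2 - a3).
Proof. rewrite /heron; ring. Qed.

Lemma heron_gt0 a1 a2 a3 : 0 < a1 -> 0 < a2 -> 0 < a3 ->
  a1 < a2 + a3 -> a2 < a3 + a1 -> a3 < a1 + a2 ->
  0 < heron (a1 ^+ 2) (a2 ^+ 2) (a3 ^+ 2).
Proof.
move=> ? ? ? ? ? ?; rewrite heron_factor.
by apply: mulr_gt0; [apply: mulr_gt0; [apply: mulr_gt0|]|]; lra.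
Qed.

Lemma heron_rot x1 x2 x3 : heron x2 x3 x1 = heron x1 x2 x3.
Proof. by rewrite /heron; ring. Qed.

Lemma pedoe_rot x1 x2 x3 y1 y2 y3 :
  pedoe x2 x3 x1 y2 y3 y1 = pedoe x1 x2 x3 y1 y2 y3.
Proof. by rewrite /pedoe; ring. Qed.

(** The angle opposite [a1], by the law of cosines. *)
Definition angle a1 a2 a3 : R := acos ((a2 ^+ 2 + a3 ^+ 2 - a1 ^+ 2) / (2 * (a2 * a3))).

Lemma law_of_cosines_itv a1 a2 a3 : 0 < a1 -> 0 < a2 -> 0 < a3 ->
  a1 < a2 + a3 -> a2 < a3 + a1 -> a3 < a1 + a2 ->
  -1 < (a2 ^+ 2 + a3 ^+ 2 - a1 ^+ 2) / (2 * (a2 * a3)) < 1.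
Proof.
move=> p1 p2 p3 t1 t2 t3.
have a23 : 0 < 2 * (a2 * a3) by rewrite !mulr_gt0.
rewrite ltr_pdivlMr // ltr_pdivrMr //; apply/andP; split.
  have : 0 < (a2 + a3 - a1) * (a2 + a3 + a1) by apply: mulr_gt0; lra.
  by nra.
have : 0 < (a1 + a2 - a3) * (a3 + a1 - a2) by apply: mulr_gt0; lra.
by nra.
Qed.

Lemma cos_angle a1 a2 a3 : 0 < a1 -> 0 < a2 -> 0 < a3 ->
  a1 < a2 + a3 -> a2 < a3 + a1 -> a3 < a1 + a2 ->
  cos (angle a1 a2 a3) = (a2 ^+ 2 + a3 ^+ 2 - a1 ^+ 2) / (2 * (a2 * a3)).
Proof.
move=> p1 p2 p3 t1 t2 t3.
have /andP[/ltW h1 /ltW h2] := law_of_cosines_itv p1 p2 p3 t1 t2 t3.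
by rewrite /angle acosK // in_itv /= h1 h2.
Qed.

Lemma angle_itv a1 a2 a3 : 0 < a1 -> 0 < a2 -> 0 < a3 ->
  a1 < a2 + a3 -> a2 < a3 + a1 -> a3 < a1 + a2 ->
  0 < angle a1 a2 a3 < pi.
Proof.
move=> p1 p2 p3 t1 t2 t3.
have /andP[h1 h2] := law_of_cosines_itv p1 p2 p3 t1 t2 t3.
by rewrite /angle acos_gt0 ?acos_ltpi // ?h1 ?h2 ?ltW.
Qed.

Lemma sin_angle a1 a2 a3 : 0 < a1 -> 0 < a2 -> 0 < a3 ->
  a1 < a2 + a3 -> a2 < a3 + a1 -> a3 < a1 + a2 ->
  sin (angle a1 a2 a3) =
  Num.sqrt (heron (a1 ^+ 2) (a2 ^+ 2) (a3 ^+ 2)) / (2 * (a2 * a3)).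
Proof.
move=> p1 p2 p3 t1 t2 t3.
have a23 : 0 < 2 * (a2 * a3) by rewrite !mulr_gt0.
have hs : 0 <= sin (angle a1 a2 a3).
  by apply: sin_ge0_pi; case/andP: (angle_itv p1 p2 p3 t1 t2 t3) => /ltW -> /ltW ->.
apply/eqP; rewrite -(@eqrXn2 _ 2) ?divr_ge0 ?sqrtr_ge0 ?(ltW a23) //; apply/eqP.
have := sqr_sqrtr (ltW (heron_gt0 p1 p2 p3 t1 t2 t3)); set k := Num.sqrt _ => kE.
rewrite sin2cos2 cos_angle //.
transitivity (k ^+ 2 / (2 * (a2 * a3)) ^+ 2); last by field; rewrite !gt_eqF.
by rewrite kE /heron; field; rewrite !gt_eqF.
Qed.

(** The sum lies between 0 and [3 * pi], so it is enough that its cosine is -1. In the expansion the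
    sines occur only in pairs, each product containing the square of the root of [heron]; what is
    left is a rational identity in the sides. *)
Lemma angle_sum a1 a2 a3 : 0 < a1 -> 0 < a2 -> 0 < a3 ->
  a1 < a2 + a3 -> a2 < a3 + a1 -> a3 < a1 + a2 ->
  angle a1 a2 a3 + angle a2 a3 a1 + angle a3 a1 a2 = pi.
Proof.
move=> p1 p2 p3 t1 t2 t3; apply: cos_eqN1.
  have := angle_itv p1 p2 p3 t1 t2 t3; have := angle_itv p2 p3 p1 t2 t3 t1.
  have := angle_itv p3 p1 p2 t3 t1 t2; lra.
rewrite !(cosD, sinD) !cos_angle ?sin_angle //.
rewrite (heron_rot (a2 ^+ 2)) (heron_rot (a1 ^+ 2)).
have := @sqr_sqrtr _ _ (ltW (heron_gt0 p1 p2 p3 t1 t2 t3)).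
set k := Num.sqrt _ => kE.
have {}kE : k ^+ 2 = (a1 + a2 + a3) * (a2 + a3 - a1) * (a3 + a1 - a2) * (a1 + a2 - a3).
  by rewrite kE heron_factor.
set C1 := (a2 ^+ 2 + _ - _) / _; set C2 := (a3 ^+ 2 + _ - _) / _.
set C3 := (a1 ^+ 2 + _ - _) / _.
transitivity (C1 * C2 * C3 - k ^+ 2 * (C3 / (4 * a1 * a2 * a3 ^+ 2)
   + C2 / (4 * a1 * a3 * a2 ^+ 2) + C1 / (4 * a2 * a3 * a1 ^+ 2))).
  by field; rewrite !gt_eqF.
by rewrite kE /C1 /C2 /C3; field; rewrite !gt_eqF.
Qed.

(** The hypothesis says that the angle opposite [a1] is at most 2 pi / 3, which is the form in which
    the Pluecker relations supply it. *)
Lemma strict_triangle a1 a2 a3 : 0 < a1 -> 0 < a2 -> 0 < a3 ->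
  a1 ^+ 2 <= a2 ^+ 2 + a3 ^+ 2 + a2 * a3 -> a1 < a2 + a3.
Proof.
move=> p1 p2 p3 h; rewrite -(@ltr_pXn2r _ 2) ?nnegrE ?addr_ge0 ?ltW //.
by have := mulr_gt0 p2 p3; nra.
Qed.

(* At an index where the two angles sum to at least 2 pi / 3 one has
   [cos (alpha + beta) <= - 1 / 2], since neither exceeds 2 pi / 3. *)
Lemma pedoe_strengthened a1 a2 a3 b1 b2 b3 e c :
  0 < a1 -> 0 < a2 -> 0 < a3 -> 0 < b1 -> 0 < b2 -> 0 < b3 ->
  a1 ^+ 2 <= a2 ^+ 2 + a3 ^+ 2 + a2 * a3 ->
  a2 ^+ 2 <= a3 ^+ 2 + a1 ^+ 2 + a3 * a1 ->
  a3 ^+ 2 <= a1 ^+ 2 + a2 ^+ 2 + a1 * a2 ->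
  b1 ^+ 2 <= b2 ^+ 2 + b3 ^+ 2 + b2 * b3 ->
  b2 ^+ 2 <= b3 ^+ 2 + b1 ^+ 2 + b3 * b1 ->
  b3 ^+ 2 <= b1 ^+ 2 + b2 ^+ 2 + b1 * b2 ->
  0 <= c <= 1 -> e <= (3 * c - 1) / 2 ->
  let rhs := pedoe (a1 ^+ 2) (a2 ^+ 2) (a3 ^+ 2) (b1 ^+ 2) (b2 ^+ 2) (b3 ^+ 2) +
    c * (Num.sqrt (heron (a1 ^+ 2) (a2 ^+ 2) (a3 ^+ 2)) *
         Num.sqrt (heron (b1 ^+ 2) (b2 ^+ 2) (b3 ^+ 2))) in
  [\/ 2 * ((a2 * b3) ^+ 2 + (a3 * b2) ^+ 2 + e * (a2 * a3 * b2 * b3)) <= rhs,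
      2 * ((a3 * b1) ^+ 2 + (a1 * b3) ^+ 2 + e * (a3 * a1 * b3 * b1)) <= rhs |
      2 * ((a1 * b2) ^+ 2 + (a2 * b1) ^+ 2 + e * (a1 * a2 * b1 * b2)) <= rhs].
Proof.
move=> pa1 pa2 pa3 pb1 pb2 pb3 ha1 ha2 ha3 hb1 hb2 hb3 hc he rhs.
have ta1 := strict_triangle pa1 pa2 pa3 ha1.
have ta2 := strict_triangle pa2 pa3 pa1 ha2.
have ta3 := strict_triangle pa3 pa1 pa2 ha3.
have tb1 := strict_triangle pb1 pb2 pb3 hb1.
have tb2 := strict_triangle pb2 pb3 pb1 hb2.
have tb3 := strict_triangle pb3 pb1 pb2 hb3.
have ge_cos x1 x2 x3 : 0 < x1 -> 0 < x2 -> 0 < x3 -> x1 < x2 + x3 ->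
    x2 < x3 + x1 -> x3 < x1 + x2 ->
    x1 ^+ 2 <= x2 ^+ 2 + x3 ^+ 2 + x2 * x3 -> - (1 / 2) <= cos (angle x1 x2 x3).
  move=> p1 p2 p3 t1 t2 t3 h; rewrite cos_angle // ler_pdivlMr ?mulr_gt0 //; lra.
(* The cosine of the half-sum lies between -1/2 and 1/2, so the double angle formula bounds the
   cosine of the sum by 2/4 - 1. *)
have le_cos x y : 0 < x < pi -> 0 < y < pi -> - (1 / 2) <= cos x ->
    - (1 / 2) <= cos y -> cos ((x + y) / 2) <= 1 / 2 -> cos (x + y) <= - (1 / 2).
  move=> hx hy cx cy ch; have hx' : 0 <= x <= pi by lra.
  have hy' : 0 <= y <= pi by lra.
  have := cos_half_ge hx' hy' cx cy; move: ch.
  have -> : cos (x + y) = 2 * cos ((x + y) / 2) ^+ 2 - 1.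
    have {1}-> : x + y = ((x + y) / 2) *+ 2 by rewrite -mulr_natr; field.
    by rewrite cos_mulr2n; ring.
  by nra.
have key x1 x2 x3 y1 y2 y3 (p1 : 0 < x1) (p2 : 0 < x2) (p3 : 0 < x3)
    (t1 : x1 < x2 + x3) (t2 : x2 < x3 + x1) (t3 : x3 < x1 + x2)
    (p1' : 0 < y1) (p2' : 0 < y2) (p3' : 0 < y3)
    (t1' : y1 < y2 + y3) (t2' : y2 < y3 + y1) (t3' : y3 < y1 + y2) :
    cos (angle x1 x2 x3 + angle y1 y2 y3) <= - (1 / 2) ->
    2 * ((x2 * y3) ^+ 2 + (x3 * y2) ^+ 2 + e * (x2 * x3 * y2 * y3)) <=
    pedoe (x1 ^+ 2) (x2 ^+ 2) (x3 ^+ 2) (y1 ^+ 2) (y2 ^+ 2) (y3 ^+ 2) +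
    c * (Num.sqrt (heron (x1 ^+ 2) (x2 ^+ 2) (x3 ^+ 2)) *
         Num.sqrt (heron (y1 ^+ 2) (y2 ^+ 2) (y3 ^+ 2))).
  have := cos_max (angle x1 x2 x3 - angle y1 y2 y3).
  rewrite ler_norml => /andP[_].
  rewrite cosB cosD !cos_angle ?sin_angle //.
  set k := Num.sqrt _; set l := Num.sqrt _ => hd hs.
  have x23 : 0 < 2 * (x2 * x3) by rewrite !mulr_gt0.
  have y23 : 0 < 2 * (y2 * y3) by rewrite !mulr_gt0.
  set cx := _ / (2 * (x2 * x3)) in hd hs; set cy := _ / (2 * (y2 * y3)) in hd hs.
  set sx := k / _ in hd hs; set sy := l / _ in hd hs.
  have kE : k = sx * (2 * (x2 * x3)) by rewrite /sx divfK ?gt_eqF.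
  have lE : l = sy * (2 * (y2 * y3)) by rewrite /sy divfK ?gt_eqF.
  have xE : x1 ^+ 2 = x2 ^+ 2 + x3 ^+ 2 - cx * (2 * (x2 * x3)).
    by rewrite /cx divfK ?gt_eqF //; ring.
  have yE : y1 ^+ 2 = y2 ^+ 2 + y3 ^+ 2 - cy * (2 * (y2 * y3)).
    by rewrite /cy divfK ?gt_eqF //; ring.
  rewrite -subr_ge0 /pedoe kE lE xE yE.
  (* The last factor is [- (1 - c) cos (x - y) - (1 + c) cos (x + y) - e] for the two angles [x] and
     [y]; the bounds 1 and -1/2 on the cosines make it at least [(3 * c - 1) / 2 - e]. *)
  rewrite (_ : _ - _ = 2 * (x2 * x3 * y2 * y3) *
     (2 * c * (sx * sy) - 2 * (cx * cy) - e)); last by ring.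
  apply: mulr_ge0; first by rewrite !mulr_ge0 // ltW.
  nra.
have sumE := angle_sum pa1 pa2 pa3 ta1 ta2 ta3.
have sumE' := angle_sum pb1 pb2 pb3 tb1 tb2 tb3.
(* The six angles sum to 2 pi, so the three half-sums sum to pi. *)
have := @exists_cos_le_half ((angle a1 a2 a3 + angle b1 b2 b3) / 2)
  ((angle a2 a3 a1 + angle b2 b3 b1) / 2) ((angle a3 a1 a2 + angle b3 b1 b2) / 2).
case=> [|/le_cos h|/le_cos h|/le_cos h]; first by lra.
- constructor 1; apply: key => //; apply: h; by [apply: angle_itv | apply: ge_cos].
- constructor 2; rewrite /rhs -pedoe_rot -(heron_rot (a1 ^+ 2)) -(heron_rot (b1 ^+ 2)).
  by apply: key => //; apply: h; by [apply: angle_itv | apply: ge_cos].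
- constructor 3; rewrite /rhs pedoe_rot (heron_rot (a3 ^+ 2)) (heron_rot (b3 ^+ 2)).
  by apply: key => //; apply: h; by [apply: angle_itv | apply: ge_cos].
Qed.

End Triangles.

(** * Conditional negativity of Pluecker arrays *)

Ltac uniq_hyps u := let H := fresh "ne" in
  have := u; rewrite /= !inE !negb_or ?andbT -?andbA => H;
  repeat (let H' := fresh "ne" in case/andP: H => H' H).
Ltac uniq_goal := rewrite /= ?inE ?negb_or ?andbT;
  repeat (apply/andP; split); first [done | by rewrite eq_sym].

Section Arrays.
Variables (R : realType) (I : finType).

(* For [e = 2 `^ q - 2] and [1 <= q <= 2] the last field relaxes the three-term
   relations of T_q, see [powRD_le]. *)
Record plucker_array (e : R) (P : I -> I -> R) : Prop := PluckerArray {
  array_sym : forall i j, P i j = P j i;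
  array_diag : forall i, P i i = 0;
  array_gt0 : forall i j, i != j -> 0 < P i j;
  array_plucker : forall i j k l, uniq [:: i; j; k; l] ->
    P i j * P k l <= P i k * P j l + P i l * P j k +
      e * Num.sqrt (P i k * P j l * (P i l * P j k))
}.

Lemma pedoe_suml (B : {set I}) (v x1 x2 x3 : I -> R) y1 y2 y3 :
  pedoe (\sum_(k in B) v k * x1 k) (\sum_(k in B) v k * x2 k)
    (\sum_(k in B) v k * x3 k) y1 y2 y3 =
  \sum_(k in B) v k * pedoe (x1 k) (x2 k) (x3 k) y1 y2 y3.
Proof.
transitivity ((\sum_(k in B) v k * x1 k) * (y1 + y2 + y3 - 2 * y1)
  + (\sum_(k in B) v k * x2 k) * (y1 + y2 + y3 - 2 * y2)
  + (\sum_(k in B) v k * x3 k) * (y1 + y2 + y3 - 2 * y3)).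
  by rewrite /pedoe; ring.
rewrite !mulr_suml -!big_split /=; apply: eq_bigr => k _.
by rewrite /pedoe; ring.
Qed.

Lemma pedoeC (x1 x2 x3 y1 y2 y3 : R) :
  pedoe x1 x2 x3 y1 y2 y3 = pedoe y1 y2 y3 x1 x2 x3.
Proof. by rewrite /pedoe; ring. Qed.

Lemma pedoexx (x1 x2 x3 : R) : pedoe x1 x2 x3 x1 x2 x3 = heron x1 x2 x3.
Proof. by rewrite /pedoe /heron; ring. Qed.

Lemma heron_sum (B : {set I}) (v x1 x2 x3 : I -> R) :
  heron (\sum_(k in B) v k * x1 k) (\sum_(k in B) v k * x2 k)
    (\sum_(k in B) v k * x3 k) =
  \sum_(k in B) \sum_(l in B) v k * v l *
    pedoe (x1 k) (x2 k) (x3 k) (x1 l) (x2 l) (x3 l).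
Proof.
rewrite -pedoexx pedoe_suml; apply: eq_bigr => k _.
rewrite pedoeC pedoe_suml mulr_sumr; apply: eq_bigr => l _.
by rewrite pedoeC; ring.
Qed.

(** Cauchy-Schwarz against the constant 1: the sum of all [(f k - f l) ^+ 2] is twice the gap. *)
Lemma sqr_sum_le (B : {set I}) (f : I -> R) :
  (\sum_(k in B) f k) ^+ 2 <= #|B|%:R * \sum_(k in B) f k ^+ 2.
Proof.
have : 0 <= \sum_(k in B) \sum_(l in B) (f k - f l) ^+ 2.
  by apply: sumr_ge0 => k _; apply: sumr_ge0 => l _; exact: sqr_ge0.
have -> : \sum_(k in B) \sum_(l in B) (f k - f l) ^+ 2 =
    2 * (#|B|%:R * \sum_(k in B) f k ^+ 2) - 2 * (\sum_(k in B) f k) ^+ 2.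
  have sumC (g : I -> R) : \sum_(k in B) \sum_(l in B) g l = #|B|%:R * \sum_(l in B) g l.
    by rewrite sumr_const mulr_natl.
  have sumC' : \sum_(k in B) \sum_(l in B) f k ^+ 2 = #|B|%:R * \sum_(l in B) f l ^+ 2.
    by rewrite exchange_big /= sumC.
  rewrite mulrDl mul1r -{1}sumC' -sumC expr2 big_distrlr /= mulrDl mul1r.
  rewrite -!(big_split, sumrB) /=; apply: eq_bigr => k _.
  by rewrite -!(big_split, sumrB) /=; apply: eq_bigr => l _; ring.
lra.
Qed.

Variables (e c : R) (P : I -> I -> R).
Hypothesis PA : plucker_array e P.
Hypotheses (c01 : 0 <= c <= 1) (ec : e <= (3 * c - 1) / 2).

Let PC := array_sym PA.

(** The roots of the three products are the sides of the triangle attached to [k], and its angles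
    are at most 2 pi / 3 because [e <= (3 * c - 1) / 2 <= 1]. *)
Lemma plucker_triangle i1 i2 i3 k : uniq [:: i1; i2; i3; k] ->
  P i2 i3 * P i1 k <= P i3 i1 * P i2 k + P i1 i2 * P i3 k
    + Num.sqrt (P i3 i1 * P i2 k) * Num.sqrt (P i1 i2 * P i3 k).
Proof.
move=> u; uniq_hyps u.
have /(array_plucker PA) : uniq [:: i2; i3; i1; k] by uniq_goal.
rewrite (PC i2 i1) => h; apply: (le_trans h); rewrite -sqrtrM; last first.
  by rewrite mulr_ge0 ?ltW ?(array_gt0 PA) // eq_sym.
have -> : P i1 i2 * P i3 k * (P i2 k * P i3 i1) =
  P i3 i1 * P i2 k * (P i1 i2 * P i3 k) by ring.
set r := Num.sqrt _; have r0 : 0 <= r by exact: sqrtr_ge0.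
have e1 : e <= 1 by have := c01; have := ec; lra.
have : e * r <= 1 * r by rewrite ler_wpM2r.
lra.
Qed.

Lemma plucker_heron_gt0 i1 i2 i3 k : uniq [:: i1; i2; i3; k] ->
  0 < heron (P i2 i3 * P i1 k) (P i3 i1 * P i2 k) (P i1 i2 * P i3 k).
Proof.
move=> u; uniq_hyps u.
have g0 i j i' : uniq [:: i; j; i'; k] -> 0 < P i j * P i' k.
  by move=> u'; uniq_hyps u'; rewrite mulr_gt0 ?(array_gt0 PA).
have x1 : 0 < P i2 i3 * P i1 k by apply: g0; uniq_goal.
have x2 : 0 < P i3 i1 * P i2 k by apply: g0; uniq_goal.
have x3 : 0 < P i1 i2 * P i3 k by apply: g0; uniq_goal.
have t1 := @plucker_triangle i1 i2 i3 k ltac:(uniq_goal).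
have t2 := @plucker_triangle i2 i3 i1 k ltac:(uniq_goal).
have t3 := @plucker_triangle i3 i1 i2 k ltac:(uniq_goal).
rewrite -[P i2 i3 * _](sqr_sqrtr (ltW x1)) -[P i3 i1 * _](sqr_sqrtr (ltW x2)).
rewrite -[P i1 i2 * _](sqr_sqrtr (ltW x3)).
by apply: heron_gt0; rewrite ?sqrtr_gt0 //; apply: strict_triangle;
  rewrite ?sqrtr_gt0 // !sqr_sqrtr // ltW.
Qed.

(** Each alternative of [pedoe_strengthened] matches the relation for one pair of the three points
    against [k], [l], so whichever holds yields the same bound. Divided by
    [2 * (P i2 i3 * P i3 i1 * P i1 i2)], the [pedoe] term is the entry at (k, l) of P_BA P_AA^-1
    P_AB for A = {i1, i2, i3}. *)
Lemma plucker_pedoe i1 i2 i3 k l : uniq [:: i1; i2; i3; k; l] ->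
  2 * (P i2 i3 * P i3 i1 * P i1 i2) * P k l <=
  pedoe (P i2 i3 * P i1 k) (P i3 i1 * P i2 k) (P i1 i2 * P i3 k)
        (P i2 i3 * P i1 l) (P i3 i1 * P i2 l) (P i1 i2 * P i3 l) +
  c * (Num.sqrt (heron (P i2 i3 * P i1 k) (P i3 i1 * P i2 k) (P i1 i2 * P i3 k)) *
       Num.sqrt (heron (P i2 i3 * P i1 l) (P i3 i1 * P i2 l) (P i1 i2 * P i3 l))).
Proof.
move=> u; uniq_hyps u.
have g0 i j : i != j -> 0 < P i j by exact: (array_gt0 PA).
have p23 : 0 < P i2 i3 by apply: g0.
have p31 : 0 < P i3 i1 by apply: g0; rewrite eq_sym.
have p12 : 0 < P i1 i2 by apply: g0.
have sq x : 0 < x -> Num.sqrt x ^+ 2 = x by move=> /ltW /sqr_sqrtr.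
have q1k : 0 < P i2 i3 * P i1 k by rewrite mulr_gt0 // g0.
have q2k : 0 < P i3 i1 * P i2 k by rewrite mulr_gt0 // g0.
have q3k : 0 < P i1 i2 * P i3 k by rewrite mulr_gt0 // g0.
have q1l : 0 < P i2 i3 * P i1 l by rewrite mulr_gt0 // g0.
have q2l : 0 < P i3 i1 * P i2 l by rewrite mulr_gt0 // g0.
have q3l : 0 < P i1 i2 * P i3 l by rewrite mulr_gt0 // g0.
have := @pedoe_strengthened _ (Num.sqrt (P i2 i3 * P i1 k)) (Num.sqrt (P i3 i1 * P i2 k))
  (Num.sqrt (P i1 i2 * P i3 k)) (Num.sqrt (P i2 i3 * P i1 l)) (Num.sqrt (P i3 i1 * P i2 l))
  (Num.sqrt (P i1 i2 * P i3 l)) e c.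
rewrite !sqrtr_gt0 !sq // => /(_ q1k q2k q3k q1l q2l q3l).
have tri a1 a2 a3 k' : uniq [:: a1; a2; a3; k'] -> _ := @plucker_triangle a1 a2 a3 k'.
move=> /(_ (tri i1 i2 i3 k ltac:(uniq_goal)) (tri i2 i3 i1 k ltac:(uniq_goal))
  (tri i3 i1 i2 k ltac:(uniq_goal)) (tri i1 i2 i3 l ltac:(uniq_goal))
  (tri i2 i3 i1 l ltac:(uniq_goal)) (tri i3 i1 i2 l ltac:(uniq_goal)) c01 ec).
(* the relation for [ab|kl], multiplied by the two other entries of the triangle *)
have rel a b d : uniq [:: a; b; d; k; l] ->
    2 * (P a b * P b d * P d a) * P k l <=
    2 * ((Num.sqrt (P b d * P a k) * Num.sqrt (P d a * P b l)) ^+ 2 +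
         (Num.sqrt (P d a * P b k) * Num.sqrt (P b d * P a l)) ^+ 2 +
         e * (Num.sqrt (P b d * P a k) * Num.sqrt (P d a * P b k) *
              Num.sqrt (P b d * P a l) * Num.sqrt (P d a * P b l))).
  move=> u'; uniq_hyps u'.
  have pbd : 0 < P b d by apply: g0.
  have pda : 0 < P d a by apply: g0; rewrite eq_sym.
  have pak : 0 < P a k by apply: g0.
  have pal : 0 < P a l by apply: g0.
  have pbk : 0 < P b k by apply: g0.
  have pbl : 0 < P b l by apply: g0.
  have nn x y : 0 < x -> 0 < y -> 0 <= x * y by move=> *; rewrite mulr_ge0 // ltW.
  rewrite !exprMn !sq ?mulr_gt0 // -!sqrtrM ?nn ?mulr_gt0 //.
  have -> : P b d * P a k * (P d a * P b k) * (P b d * P a l) * (P d a * P b l) =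
    (P b d * P d a) ^+ 2 * (P a k * P b l * (P a l * P b k)) by ring.
  rewrite sqrtrM ?sqr_ge0 // sqrtr_sqr gtr0_norm ?mulr_gt0 //.
  have /(array_plucker PA) : uniq [:: a; b; k; l] by uniq_goal.
  set r := Num.sqrt _ => h.
  have -> : 2 * (P a b * P b d * P d a) * P k l = 2 * (P b d * P d a * (P a b * P k l)).
    by ring.
  rewrite ler_pM2l //.
  have -> : P b d * P a k * (P d a * P b l) + P d a * P b k * (P b d * P a l) +
    e * (P b d * P d a * r) = P b d * P d a * (P a k * P b l + P a l * P b k + e * r).
    by ring.
  by rewrite ler_pM2l ?mulr_gt0.
case=> h; apply: le_trans h.
- apply: le_trans (rel i2 i3 i1 ltac:(uniq_goal)).
  by rewrite le_eqVlt; apply/orP; left; apply/eqP; ring.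
- apply: le_trans (rel i3 i1 i2 ltac:(uniq_goal)).
  by rewrite le_eqVlt; apply/orP; left; apply/eqP; ring.
- apply: le_trans (rel i1 i2 i3 ltac:(uniq_goal)).
  by rewrite le_eqVlt; apply/orP; left; apply/eqP; ring.
Qed.

Definition cross (B : {set I}) (v : I -> R) i := \sum_(k in B) v k * P i k.

(** The Schur complement is nonnegative at [v]: up to scale its diagonal terms are [h k ^+ 2] and
    its off-diagonal ones at least [- c * h k * h l]. The total is at least [(1 + c) * \sum h ^+ 2 -
    c * (\sum h) ^+ 2], which Cauchy-Schwarz makes nonnegative for [c * #|B| <= 1 + c]. *)
Lemma heron_cross_ge i1 i2 i3 (B : {set I}) (v : I -> R) :
  uniq [:: i1; i2; i3] -> i1 \notin B -> i2 \notin B -> i3 \notin B ->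
  c * #|B|%:R <= 1 + c -> (forall k, k \in B -> 0 <= v k) ->
  2 * (P i2 i3 * P i3 i1 * P i1 i2) * (\sum_(k in B) \sum_(l in B) v k * v l * P k l) <=
  heron (P i2 i3 * cross B v i1) (P i3 i1 * cross B v i2) (P i1 i2 * cross B v i3).
Proof.
move=> u iB1 iB2 iB3 cB v0.
pose x1 k := P i2 i3 * P i1 k; pose x2 k := P i3 i1 * P i2 k.
pose x3 k := P i1 i2 * P i3 k.
have crossE r i : r * cross B v i = \sum_(k in B) v k * (r * P i k).
  by rewrite mulr_sumr; apply: eq_bigr => k _; ring.
rewrite !crossE (heron_sum B v x1 x2 x3) -subr_ge0.
pose h k := v k * Num.sqrt (heron (x1 k) (x2 k) (x3 k)).
have h2 : (1 + c) * (\sum_(k in B) h k ^+ 2) - c * (\sum_(k in B) h k) ^+ 2 >= 0.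
  have := sqr_sum_le B h; have : 0 <= \sum_(k in B) h k ^+ 2.
    by apply: sumr_ge0 => k _; exact: sqr_ge0.
  have /andP[c0 _] := c01.
  set S := \sum_(k in B) _ ^+ 2; move=> S0 hS.
  have : c * (\sum_(k in B) h k) ^+ 2 <= c * #|B|%:R * S.
    by rewrite -mulrA ler_wpM2l.
  nra.
apply: (le_trans h2).
rewrite expr2 big_distrlr /= !mulr_sumr -!sumrB; apply: ler_sum => k kB.
(* Spreading the diagonal term over [l] by an indicator allows a termwise comparison of double
   sums. *)
have -> : (1 + c) * h k ^+ 2 = \sum_(l in B) (l == k)%:R * ((1 + c) * h k ^+ 2).
  rewrite (bigD1 k) //= eqxx mul1r big1 ?addr0 // => l /andP[_ /negPf ->].
  by rewrite mul0r.
rewrite !mulr_sumr -!sumrB; apply: ler_sum => l lB.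
have ne i j : i \notin B -> j \in B -> i != j.
  by move=> iB; apply: contraTneq => <-.
have k1 := ne _ _ iB1 kB; have k2 := ne _ _ iB2 kB; have k3 := ne _ _ iB3 kB.
have u' : l != k -> uniq [:: i1; i2; i3; k; l].
  move=> lk; uniq_hyps u.
  have := (ne _ _ iB1 lB, ne _ _ iB2 lB, ne _ _ iB3 lB).
  by move=> [[? ?] ?]; uniq_goal.
have [->|lk] := eqVneq l k.
  rewrite (array_diag PA) mul1r /h expr2 pedoexx.
  have h0 : 0 <= heron (x1 k) (x2 k) (x3 k).
    by apply/ltW/plucker_heron_gt0; uniq_hyps u; uniq_goal.
  rewrite -[X in _ <= _ * X - _](sqr_sqrtr h0).
  by rewrite le_eqVlt; apply/orP; left; apply/eqP; ring.
have vkl : 0 <= v k * v l by rewrite mulr_ge0 // v0.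
rewrite mul0r sub0r /h.
have := ler_wpM2l vkl (plucker_pedoe (u' lk)).
rewrite -/(x1 k) -/(x2 k) -/(x3 k) -/(x1 l) -/(x2 l) -/(x3 l); lra.
Qed.
End Arrays.

(** [heron] is the dual of the Lorentzian form [t1 * t2 + t2 * t3 + t3 * t1]: the two matrices are
    inverse to each other. Multiplied by [E1 ^+ 2], the gap is a square plus a nonnegative multiple
    of a square. *)
Lemma reverse_cauchy_schwarz (R : realType) (t1 t2 t3 E1 E2 E3 : R) :
  0 < E1 -> 0 <= heron E1 E2 E3 ->
  (t1 * t2 + t2 * t3 + t3 * t1) * heron E1 E2 E3 <=
  (t1 * E1 + t2 * E2 + t3 * E3) ^+ 2.
Proof.
move=> E0; have : heron E1 E2 E3 =
  2 * (E1 * E2 + E2 * E3 + E3 * E1) - (E1 ^+ 2 + E2 ^+ 2 + E3 ^+ 2) by [].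
set H := heron _ _ _ => HE H0.
rewrite -subr_ge0 -(pmulr_rge0 _ (exprn_gt0 2 E0)).
have -> : E1 ^+ 2 * ((t1 * E1 + t2 * E2 + t3 * E3) ^+ 2
    - (t1 * t2 + t2 * t3 + t3 * t1) * H) =
  (E1 ^+ 2 * t1 + (E1 * E2 - H / 2) * t2 + (E1 * E3 - H / 2) * t3) ^+ 2
  + H / 4 * ((E1 + E2 - E3) * t2 - (E1 + E3 - E2) * t3) ^+ 2.
  by rewrite HE; field.
by apply: addr_ge0; [exact: sqr_ge0 | apply: mulr_ge0; [exact: divr_ge0 | exact: sqr_ge0]].
Qed.

Lemma big_disjoint_setU (R : nmodType) (I : finType) (A B : {set I}) (F : I -> R) :
  [disjoint A & B] ->
  \sum_(i in A :|: B) F i = \sum_(i in A) F i + \sum_(i in B) F i.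
Proof.
by move=> dAB; rewrite -bigU //=; apply: eq_bigl => i; rewrite !inE.
Qed.

Lemma card_between (T : finType) (A D : {set T}) m :
  A \subset D -> (#|A| <= m <= #|D|)%N ->
  exists B : {set T}, [/\ A \subset B, B \subset D & #|B| = m].
Proof.
elim: m => [|m IHm] AD /andP[Am mD].
  by exists A; split => //; apply/eqP; rewrite -leqn0.
move: Am; rewrite leq_eqVlt => /orP[/eqP Am|Am]; first by exists A.
have [|B [AB BD Bm]] := IHm AD; first by rewrite -ltnS Am ltnW.
have /card_gt0P[x] : (0 < #|D :\: B|)%N by rewrite cardsDS // Bm subn_gt0.
rewrite inE => /andP[xB xD]; exists (x |: B); split.
- by rewrite (subset_trans AB) // finset.subsetUr.
- by rewrite finset.subUset sub1set xD.
- by rewrite cardsU1 xB Bm.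
Qed.

(** * The quadratic form of an array on the hyperplane of one point *)

Section NegativeType.
Variables (R : realType) (I : finType).
Variables (e c : R) (P : I -> I -> R).
Hypothesis PA : plucker_array e P.
Hypotheses (c01 : 0 <= c <= 1) (ec : e <= (3 * c - 1) / 2).
Implicit Types (A B : {set I}) (u v w : I -> R).

Definition form (A B : {set I}) (u v : I -> R) :=
  \sum_(i in A) \sum_(k in B) u i * v k * P i k.

Lemma formC A B u v : form A B u v = form B A v u.
Proof.
rewrite /form exchange_big; apply: eq_bigr => k _; apply: eq_bigr => i _.
by rewrite (array_sym PA k); ring.
Qed.

Lemma form_cross A B u v : form A B u v = \sum_(i in A) u i * cross P B v i.
Proof.
by apply: eq_bigr => i _; rewrite mulr_sumr; apply: eq_bigr => k _; ring.
Qed.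

Lemma formUl A A' B u v : [disjoint A & A'] ->
  form (A :|: A') B u v = form A B u v + form A' B u v.
Proof. by move=> dA; rewrite /form big_disjoint_setU. Qed.

Lemma formUr A B B' u v : [disjoint B & B'] ->
  form A (B :|: B') u v = form A B u v + form A B' u v.
Proof. by move=> dB; rewrite !(formC A) formUl. Qed.

Lemma form1 i B u v : form [set i] B u v = u i * cross P B v i.
Proof. by rewrite form_cross big_set1. Qed.

Lemma cross1 i j v : cross P [set j] v i = v j * P i j.
Proof. by rewrite /cross big_set1. Qed.

Lemma crossU B B' v i : [disjoint B & B'] ->
  cross P (B :|: B') v i = cross P B v i + cross P B' v i.
Proof. by move=> dB; rewrite /cross big_disjoint_setU. Qed.

Lemma crossN B v i : cross P B (fun k => - v k) i = - cross P B v i.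
Proof. by rewrite /cross -sumrN; apply: eq_bigr => k _; rewrite mulNr. Qed.

Lemma big_triple (T : zmodType) i1 i2 i3 (F : I -> T) : uniq [:: i1; i2; i3] ->
  \sum_(i in [set i1; i2; i3]) F i = F i1 + F i2 + F i3.
Proof.
move=> u; uniq_hyps u.
have -> : [set i1; i2; i3] = i1 |: (i2 |: [set i3]) by rewrite finset.setUA.
by rewrite !big_setU1 ?big_set1 //= ?addrA //; uniq_goal.
Qed.

(* For A = {i1, i2, z}, the vector of [w] on A minus the solution of
   [P_AA xi = P_AB v] is orthogonal to the null vector of [z] for the Lorentzian
   form P_AA, hence has nonpositive square. *)
Lemma form_le0_pair i1 i2 z (B := ~: [set i1; i2; z]) (w : I -> R) :
  uniq [:: i1; i2; z] -> c * #|B|%:R <= 1 + c ->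
  (forall k, k \in B -> w k <= 0) -> cross P setT w z = 0 ->
  form setT setT w w <= 0.
Proof.
move=> u cB w0 wz; uniq_hyps u.
have Bv k : k \in B -> 0 <= - w k by move=> /w0; rewrite oppr_ge0.
have dB : [disjoint [set i1; i2; z] & B] by rewrite -setI_eq0 finset.setICr.
have notB i : i \in [set i1; i2; z] -> i \notin B by move=> iA; rewrite in_setC iA.
have := heron_cross_ge PA c01 ec u _ _ _ cB Bv.
rewrite !notB ?inE ?eqxx ?orbT // => /(_ isT isT isT).
have -> : \sum_(k in B) \sum_(l in B) - w k * - w l * P k l = form B B w w.
  by apply: eq_bigr => k _; apply: eq_bigr => l _; ring.
rewrite !crossN.
have setTE : setT = [set i1; i2; z] :|: B by rewrite finset.setUCr.
have crossE i : cross P setT w i = w i1 * P i i1 + w i2 * P i i2 + w z * P i z + cross P B w i.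
  by rewrite setTE crossU // /cross big_triple.
have PC := array_sym PA; have P0 := array_diag PA.
have wz' : w i1 * P z i1 + w i2 * P i2 z + cross P B w z = 0.
  by rewrite -wz crossE P0 (PC z i2) mulr0 addr0.
(* All terms in [w z] cancel, as they add up to a multiple of the constraint. *)
have -> : form setT setT w w = 2 * P i1 i2 * w i1 * w i2 + form B B w w
    + 2 * w i1 * cross P B w i1 + 2 * w i2 * cross P B w i2.
  rewrite form_cross {1}setTE big_disjoint_setU // big_triple // wz mulr0 addr0.
  have -> : \sum_(i in B) w i * cross P setT w i = w i1 * cross P B w i1
      + w i2 * cross P B w i2 + w z * cross P B w z + form B B w w.
    by rewrite -form_cross formC setTE formUl // form_cross big_triple.
  rewrite !crossE !P0 (PC i2 i1) (PC i1 z).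
  have -> : cross P B w z = - (w i1 * P z i1 + w i2 * P i2 z) by lra.
  ring.
have p12 : 0 < P i1 i2 by apply: (array_gt0 PA).
have p2z : 0 < P i2 z by apply: (array_gt0 PA).
have pz1 : 0 < P z i1 by apply: (array_gt0 PA); rewrite eq_sym.
move: wz' p12 p2z pz1; set r1 := P i2 z; set r2 := P z i1; set r3 := P i1 i2.
set n1 := cross P B w i1; set n2 := cross P B w i2; set n3 := cross P B w z.
set b := form B B w w => wz' r30 r10 r20 hb.
have f0 : 0 < 2 * (r1 * r2 * r3) by rewrite !mulr_gt0.
rewrite -(pmulr_rle0 _ f0).
(* With [n3] eliminated by the constraint, the form is the nonpositive difference from
   [heron_cross_ge] minus a square. *)
have -> : 2 * (r1 * r2 * r3) * (2 * r3 * w i1 * w i2 + b + 2 * w i1 * n1 + 2 * w i2 * n2) =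
  (2 * (r1 * r2 * r3) * b - heron (r1 * - n1) (r2 * - n2) (r3 * - n3))
  - (r2 * r3 * w i1 - r1 * r3 * w i2 - r1 * n1 + r2 * n2) ^+ 2.
  have -> : n3 = - (w i1 * r2 + w i2 * r1) by lra.
  by rewrite /heron; ring.
by have := sqr_ge0 (r2 * r3 * w i1 - r1 * r3 * w i2 - r1 * n1 + r2 * n2); lra.
Qed.

Lemma card3P A : #|A| = 3%N ->
  exists i1 i2 i3, uniq [:: i1; i2; i3] /\ A = [set i1; i2; i3].
Proof.
move=> A3; have /card_gt0P[i iA] : (0 < #|A|)%N by rewrite A3.
have : #|A :\ i| == 2%N by move: A3; rewrite (cardsD1 i) iA add1n => -[->].
move=> /cards2P[j [k [jk Ai]]]; exists i, j, k.
have AE : A = i |: [set j; k] by rewrite -Ai finset.setD1K.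
split; last by rewrite AE finset.setUA.
have : i \notin [set j; k] by rewrite -Ai !inE eqxx.
by rewrite !inE negb_or => /andP[ij ik]; uniq_goal.
Qed.

(** The point [z] joins [B] with weight [tau], so [heron_cross_ge] is needed for one more point;
    hence the bound 1 on [c * #|B|]. Since [u] and [v] agree on the row of [z], this adds [tau * g]
    to the mixed form and [2 * tau * g] to that of [B]. The assumption [m < a] makes [tau]
    positive. *)
Lemma form_le_of_lt A B z u v :
  #|A| = 3%N -> [disjoint A & B] -> z \notin A -> z \notin B ->
  c * #|B|%:R <= 1 ->
  (forall i, i \in A -> 0 < u i) -> (forall k, k \in B -> 0 <= v k) ->
  cross P A u z = cross P B v z ->
  form A B u v < form A A u u ->
  form A A u u + form B B v v <= 2 * form A B u v.
Proof.
move=> A3 dAB zA zB cB u0 v0 uvz lt_ba.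
have [i1 [i2 [i3 [uq AE]]]] := card3P A3; uniq_hyps uq.
have P0 := array_diag PA; have PC := array_sym PA.
have Pge0 i j : 0 <= P i j.
  by have [->|ij] := eqVneq i j; [rewrite P0 | rewrite ltW ?(array_gt0 PA)].
have g0 : 0 < cross P B v z.
  rewrite -uvz /cross AE big_triple // !addr_gt0 // mulr_gt0 ?(array_gt0 PA)
    ?u0 ?AE ?inE ?eqxx ?orbT //;
  by apply: contraNneq zA => ->; rewrite AE !inE eqxx ?orbT.
set a := form A A u u in lt_ba *; set m := form A B u v in lt_ba *.
set b := form B B v v; set g := cross P B v z in g0.
have m0 : 0 <= m.
  apply: sumr_ge0 => i iA; apply: sumr_ge0 => k kB.
  by rewrite !mulr_ge0 ?v0 // ltW ?u0.
have b0 : 0 <= b.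
  by apply: sumr_ge0 => i iB; apply: sumr_ge0 => k kB; rewrite !mulr_ge0 ?v0.
(* this choice turns the reverse Cauchy-Schwarz inequality [a * (b + 2 * s) <=
   (m + s) ^+ 2], for [s = tau * g], into a linear one *)
pose tau := (a - m) / g.
have tau0 : 0 < tau by rewrite divr_gt0 // subr_gt0.
have taug : tau * g = a - m by rewrite /tau divfK // gt_eqF.
pose vt k := if k == z then tau else v k.
have vtB (F : I -> I -> R) i : \sum_(k in B) vt k * F i k = \sum_(k in B) v k * F i k.
  by apply: eq_bigr => k kB; rewrite /vt; case: eqP => // kz; rewrite -kz kB in zB.
have crossE i : cross P (z |: B) vt i = tau * P i z + cross P B v i.
  by rewrite /cross big_setU1 // /vt eqxx -/vt -vtB.
have formE : form (z |: B) (z |: B) vt vt = b + 2 * (a - m).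
  rewrite form_cross big_setU1 //= {1}/vt eqxx.
  have -> : \sum_(i in B) vt i * cross P (z |: B) vt i = tau * g + b.
    rewrite (vtB (fun _ => cross P (z |: B) vt) z).
    rewrite mulr_sumr /b form_cross -big_split /=; apply: eq_bigr => k _.
    by rewrite crossE (PC z k); ring.
  by rewrite crossE P0 mulr0 add0r -/g -taug; ring.
have notB i : i \in A -> i \notin z |: B.
  move=> iA; rewrite !inE negb_or (disjointFr dAB iA) andbT.
  by apply: contraNneq zA => <-.
have vt0 k : k \in z |: B -> 0 <= vt k.
  by rewrite !inE /vt; case: eqP => [_ _|_ /= /v0//]; exact: ltW.
have cB' : c * #|z |: B|%:R <= 1 + c.
  by rewrite cardsU1 zB natrD mulrDr mulr1 addrC lerD2r.
have i1A : i1 \in A by rewrite AE !inE eqxx.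
have i2A : i2 \in A by rewrite AE !inE eqxx orbT.
have i3A : i3 \in A by rewrite AE !inE eqxx orbT.
have := heron_cross_ge PA c01 ec uq (notB _ i1A) (notB _ i2A) (notB _ i3A) cB' vt0.
rewrite [X in _ * X <= _ -> _]formE.
set h := heron _ _ _ => hH.
have p12 : 0 < P i1 i2 by apply: (array_gt0 PA).
have p23 : 0 < P i2 i3 by apply: (array_gt0 PA).
have p31 : 0 < P i3 i1 by apply: (array_gt0 PA); rewrite eq_sym.
have aE : a = 2 * (u i1 * u i2 * P i1 i2 + u i2 * u i3 * P i2 i3 + u i3 * u i1 * P i3 i1).
  rewrite /a form_cross AE /cross !big_triple // !P0 (PC i2 i1) (PC i3 i2) (PC i1 i3).
  ring.
have f0 : 0 < P i2 i3 * P i3 i1 * P i1 i2 by rewrite !mulr_gt0.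
have H0 : 0 <= h by apply: le_trans hH; rewrite mulr_ge0 //; lra.
have E1 : 0 < P i2 i3 * cross P (z |: B) vt i1.
  rewrite mulr_gt0 // crossE ltr_pwDl //.
    rewrite mulr_gt0 // (array_gt0 PA) //.
    by apply: contraNneq zA => <-.
  by apply: sumr_ge0 => k kB; rewrite mulr_ge0 ?v0.
(* Dividing [u] by the opposite entries makes the pairing equal to [m + tau * g = a], and turns the
   form in [t] into [a] over twice the product of the three entries. *)
have := @reverse_cauchy_schwarz R (u i1 / P i2 i3) (u i2 / P i3 i1)
  (u i3 / P i1 i2) _ _ _ E1 H0.
rewrite -/h.
have -> : u i1 / P i2 i3 * (P i2 i3 * cross P (z |: B) vt i1) +
   u i2 / P i3 i1 * (P i3 i1 * cross P (z |: B) vt i2) +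
   u i3 / P i1 i2 * (P i1 i2 * cross P (z |: B) vt i3) = a.
  transitivity (\sum_(i in A) u i * cross P (z |: B) vt i).
    by rewrite AE big_triple //; field; rewrite !gt_eqF.
  transitivity (tau * cross P A u z + m); last by rewrite uvz taug; ring.
  rewrite /m form_cross mulr_sumr -big_split /=; apply: eq_bigr => i _.
  by rewrite crossE (PC z i); ring.
have -> : u i1 / P i2 i3 * (u i2 / P i3 i1) + u i2 / P i3 i1 * (u i3 / P i1 i2) +
   u i3 / P i1 i2 * (u i1 / P i2 i3) = a / (2 * (P i2 i3 * P i3 i1 * P i1 i2)).
  by rewrite aE; field; rewrite !gt_eqF.
move=> hrev.
have a0 : 0 < a by lra.
have : a * (b + 2 * (a - m)) <= a ^+ 2.
  apply: le_trans hrev; rewrite -mulrA; apply: (ler_wpM2l (ltW a0)).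
  by rewrite [X in _ <= X]mulrC ler_pdivlMr ?mulr_gt0 // mulrC.
rewrite expr2 ler_pM2l //; lra.
Qed.

Lemma formN A B w : form A B (fun k => - w k) (fun k => - w k) = form A B w w.
Proof. by apply: eq_bigr => i _; apply: eq_bigr => k _; ring. Qed.

(** The positive points extend to a set of exactly two points other than [z]. The remaining
    [#|I| - 3] coordinates are nonpositive, and [c * (#|I| - 4) <= 1] is the cardinality condition
    of [form_le0_pair]. *)
Lemma form_le0_card_le2 z w : (3 < #|I|)%N -> c * (#|I|%:R - 4) <= 1 ->
  cross P setT w z = 0 ->
  (#|[set k | (k != z) && (0 < w k)%R]| <= 2)%N ->
  form setT setT w w <= 0.
Proof.
move=> I3 cI wz; set pos := [set k | _] => pos2.
have [||A [posA Az A2]] := @card_between I pos (~: [set z]) 2.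
- by apply/subsetP => k; rewrite !inE => /andP[].
- by rewrite pos2 cardsC1; lia.
have /cards2P[i1 [i2 [ne12 AE]]] : #|A| == 2%N by rewrite A2.
have zA : z \notin A by apply/negP => /(subsetP Az); rewrite !inE eqxx.
have u : uniq [:: i1; i2; z].
  by move: zA; rewrite AE !inE negb_or => /andP[? ?]; uniq_goal.
have BE : [set i1; i2; z] = z |: A by rewrite AE finset.setUC.
apply: (form_le0_pair u) => //.
  rewrite BE cardsCs finset.setCK cardsU1 zA A2 natrB; last by lia.
  have := cI; set n := #|I|%:R; rewrite [(_ + _)%N]/=; lra.
move=> k; rewrite BE !inE negb_or => /andP[kz kA]; rewrite leNgt.
by apply: contra kA => wk; apply: (subsetP posA); rewrite inE kz.
Qed.

(** Up to the sign of [w], the previous lemma leaves at least three positive and three negative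
    coordinates besides [z], which fill all seven points. The form is then [a + b - 2 * m], with [a]
    and [b] the forms of the two sides and [m] the mixed one. Either [m] is at least both [a] and
    [b], or [form_le_of_lt] applies to the side that exceeds it. *)
Lemma plucker_array_form_le0 z w :
  (3 < #|I| <= 7)%N -> c * (#|I|%:R - 4) <= 1 -> cross P setT w z = 0 ->
  form setT setT w w <= 0.
Proof.
move=> /andP[I3 I7] cI wz.
have wNz : cross P setT (fun k => - w k) z = 0 by rewrite crossN wz oppr0.
pose pos := [set k | (k != z) && (0 < w k)%R].
pose neg := [set k | (k != z) && (0 < - w k)%R].
have [pos2|pos3] := leqP #|pos| 2; first exact: (@form_le0_card_le2 z).
have [neg2|neg3] := leqP #|neg| 2.
  by rewrite -formN; exact: (@form_le0_card_le2 z).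
have dpn : [disjoint pos & neg].
  rewrite -setI_eq0; apply/eqP/setP => k; rewrite !inE.
  by apply/negP => /andP[/andP[_ ?] /andP[_ ?]]; lra.
have pnz : pos :|: neg \subset ~: [set z].
  by apply/subsetP => k; rewrite !inE => /orP[] /andP[].
have cardpn : #|pos :|: neg| = (#|pos| + #|neg|)%N.
  by rewrite cardsU disjoint_setI0 // cards0 subn0.
have le6 : (#|pos :|: neg| <= 6)%N.
  by apply: leq_trans (subset_leq_card pnz) _; rewrite cardsC1; lia.
have [pE nE] : #|pos| = 3%N /\ #|neg| = 3%N by move: le6; rewrite cardpn; lia.
have IE : #|I| = 7%N.
  by have := subset_leq_card pnz; rewrite cardsC1 cardpn pE nE; lia.
have TE : pos :|: neg = ~: [set z].
  by apply/eqP; rewrite eqEcard pnz cardsC1 cardpn pE nE IE.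
have c3 : c * 3%:R <= 1 by have := cI; rewrite IE; lra.
have zpos : z \notin pos by rewrite inE eqxx.
have zneg : z \notin neg by rewrite inE eqxx.
have Pzz : P z z = 0 := array_diag PA z.
have setTE : setT = [set z] :|: (pos :|: neg) by rewrite TE finset.setUCr.
have dzT : [disjoint [set z] & pos :|: neg].
  by rewrite TE -setI_eq0 finset.setICr.
have cT : cross P (pos :|: neg) w z = 0.
  by rewrite -wz setTE [RHS]crossU // cross1 Pzz mulr0 add0r.
have wpn : cross P pos w z = cross P neg (fun k => - w k) z.
  by apply/eqP; rewrite -subr_eq0 crossN opprK -crossU // cT.
pose v k := - w k.
have -> : form setT setT w w = form pos pos w w + form neg neg v v - 2 * form pos neg w v.
  rewrite form_cross {1}setTE big_disjoint_setU // big_set1 wz mulr0 add0r.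
  rewrite -form_cross formC setTE formUl // form1.
  rewrite cT mulr0 add0r formUl // !formUr // formN (formC neg pos).
  have -> : form pos neg w v = - form pos neg w w.
    by rewrite /form -sumrN; apply: eq_bigr => i _; rewrite -sumrN; apply: eq_bigr => k _;
       rewrite /v; ring.
  ring.
have w0 i : i \in pos -> 0 < w i by rewrite inE => /andP[].
have v0 i : i \in neg -> 0 < v i by rewrite inE => /andP[].
rewrite subr_le0.
have [lta|ltb] := ltP (form pos neg w v) (form pos pos w w).
  by apply: (form_le_of_lt (z := z)) => //; [rewrite nE | move=> k /v0/ltW].
have [lta|ltb'] := ltP (form pos neg w v) (form neg neg v v); last by lra.
rewrite (formC pos) addrC; rewrite (formC pos) in lta.
apply: (form_le_of_lt (z := z)) => //; rewrite ?pE // 1?disjoint_sym //.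
by move=> k /w0/ltW.
Qed.

End NegativeType.

(** * From the triangular hyperfield to Pluecker arrays *)

Section PowerInequality.
Import functions topology normedtype sequences derive realfun.
Import numFieldNormedType.Exports.
Variable R : realType.
Implicit Types (x y s t q h : R).

Lemma ln_leB1 x : 0 < x -> ln x <= x - 1.
Proof.
move=> x0; have := @le_ln1Dx R (x - 1).
have -> : 1 + (x - 1) = x by ring.
by apply; lra.
Qed.

(** Weighted AM-GM for [x] and 1: add [ln y <= y - 1] at [x / W] and [1 / W] with weights [t] and
    [1 - t]; the right-hand sides cancel. *)
Lemma powR_bernoulli x t : 0 < x -> 0 <= t <= 1 -> x `^ t <= 1 - t + t * x.
Proof.
move=> x0 /andP[t0 t1]; set W := 1 - t + t * x.
have W0 : 0 < W by rewrite /W; nra.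
rewrite /powR gt_eqF // -ler_ln ?posrE ?expR_gt0 // expRK.
have h1 := ln_leB1 (divr_gt0 x0 W0); have h2 := ln_leB1 (divr_gt0 ltr01 W0).
rewrite !ln_div ?posrE // ln1 in h1 h2.
have : t * (ln x - ln W) <= t * (x / W - 1) by rewrite ler_wpM2l.
have : (1 - t) * (0 - ln W) <= (1 - t) * (1 / W - 1) by rewrite ler_wpM2l ?subr_ge0.
have : t * (x / W - 1) + (1 - t) * (1 / W - 1) = 0.
  by rewrite /W; field; rewrite gt_eqF.
lra.
Qed.

(** With [z = expR (- (2 * h))] and the factor [expR (q * h)] removed, the claim is [z * z ^ (q - 1)
    + (1 + z) ^ (q - 1) * (1 - z) <= 1]. Bernoulli's bounds on the two powers add up to exactly
    1. *)
Lemma expR_sub_powR_ge0 q h : 1 <= q <= 2 -> 0 <= h ->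
  0 <= expR (q * h) - expR (- (q * h)) -
    (expR h + expR (- h)) `^ (q - 1) * (expR h - expR (- h)).
Proof.
move=> q12 h0; set z := expR (- (2 * h)).
have z0 : 0 < z by exact: expR_gt0.
have z0le := ltW z0.
have z1 : z <= 1 by rewrite -expR0 ler_expR; lra.
have t01 : 0 <= q - 1 <= 1 by lra.
have E1 : expR (- h) = expR h * z by rewrite -expRD; congr expR; ring.
have E2 : expR (- (q * h)) = expR (q * h) * (z * z `^ (q - 1)).
  rewrite /powR gt_eqF // /z expRK -!expRD; congr expR; ring.
have E3 : (expR h + expR (- h)) `^ (q - 1) * expR h = expR (q * h) * (1 + z) `^ (q - 1).
  have -> : expR h + expR (- h) = expR h * (1 + z) by rewrite E1; ring.
  rewrite powRM ?expR_ge0 ?(addr_ge0 ler01 z0le) // {1}/powR gt_eqF ?expR_gt0 // expRK.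
  rewrite mulrAC -expRD; congr (expR _ * _); ring.
have -> : expR h - expR (- h) = expR h * (1 - z) by rewrite E1; ring.
rewrite mulrA E3 E2.
rewrite (_ : _ - _ = expR (q * h) * (1 - z * z `^ (q - 1) - (1 + z) `^ (q - 1) * (1 - z)));
  last by ring.
apply: mulr_ge0; first exact: expR_ge0.
have b1 := powR_bernoulli z0 t01.
have z10 : 0 < 1 + z by lra.
have b2 := powR_bernoulli z10 t01.
have : z * z `^ (q - 1) <= z * (1 - (q - 1) + (q - 1) * z) by rewrite ler_wpM2l // ltW.
have : (1 + z) `^ (q - 1) * (1 - z) <= (1 - (q - 1) + (q - 1) * (1 + z)) * (1 - z).
  by rewrite ler_wpM2r // subr_ge0.
nra.
Qed.

Lemma is_derive_mull a x : is_derive x (1 : R) ( *%R a) a.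
Proof.
have := @is_deriveZ _ _ _ (@id R) a x 1 1 (is_derive_id _ _).
by rewrite [_ *: _]mulr1.
Qed.

Lemma is_derive_expR_mull a x :
  is_derive x (1 : R) (expR \o *%R a) (expR (a * x) * a).
Proof. exact: (is_derive1_comp (is_derive_expR _) (is_derive_mull a x)). Qed.

(** Equality holds at [h = 0], and the derivative of the gap is [q] times the quantity of
    [expR_sub_powR_ge0]. *)
Lemma powR_expRD_le q h : 1 <= q <= 2 -> 0 <= h ->
  (expR h + expR (- h)) `^ q <= expR (q * h) + expR (- (q * h)) + (2 `^ q - 2).
Proof.
move=> q12 h0.
pose E a : R -> R := expR \o *%R a.
pose G := (E q + E (- q)) - ((fun y : R => y `^ q) \o (E 1 + E (- 1))).
pose dG x := (expR (q * x) * q + expR (- q * x) * - q) -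
  (q * (E 1 x + E (- 1) x) `^ (q - 1)) * (expR (1 * x) * 1 + expR (- 1 * x) * -1).
have dGE x : is_derive x 1 G (dG x).
  have S0 : 0 < E 1 x + E (- 1) x by rewrite addr_gt0 ?expR_gt0.
  have d1 : is_derive x 1 (E q + E (- q)) (expR (q * x) * q + expR (- q * x) * - q).
    exact: (is_deriveD (is_derive_expR_mull q x) (is_derive_expR_mull (- q) x)).
  have d2 : is_derive x 1 (E 1 + E (- 1)) (expR (1 * x) * 1 + expR (- 1 * x) * - 1).
    exact: (is_deriveD (is_derive_expR_mull 1 x) (is_derive_expR_mull (- 1) x)).
  have d3 := @is_derive1_comp R (fun y : R => y `^ q) _ x _ _ (is_derive1_powR q S0) d2.
  exact: (is_deriveB d1 d3).
suff : G 0 <= G h.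
  rewrite /G /E !fctE /= !mulr0 !expR0 !mul1r !mulNr !mul1r.
  by have -> : 1 + 1 = 2 :> R by []; lra.
have [//|x xi Gx] := @MVT_segment R G dG 0 h h0 (fun x _ => dGE x).
  apply: derivable_within_continuous => x _; exact: ex_derive.
rewrite -subr_ge0 Gx subr0 mulr_ge0 //.
have x0 : 0 <= x by rewrite (itvP xi).
have := expR_sub_powR_ge0 q12 x0.
rewrite /dG /E /= !mul1r !mulNr !mul1r => hx.
rewrite (_ : _ - _ = q * (expR (q * x) - expR (- (q * x)) -
  (expR x + expR (- x)) `^ (q - 1) * (expR x - expR (- x)))); last by ring.
by rewrite mulr_ge0 //; lra.
Qed.

(** Both sides are homogeneous of degree [q]; dividing by the geometric mean [expR m] of [x] and [y]
    leaves [expR h] and [expR (- h)]. *)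
Lemma powRD_le q x y : 1 <= q <= 2 -> 0 <= x -> 0 <= y ->
  (x + y) `^ q <= x `^ q + y `^ q + (2 `^ q - 2) * Num.sqrt (x `^ q * y `^ q).
Proof.
move=> q12; have q0 : q != 0 by rewrite gt_eqF //; lra.
wlog yx : x y / y <= x => [hw x0 y0|].
  case: (leP y x) => [/hw|/ltW /hw]; first exact.
  by rewrite addrC (mulrC (y `^ q)) [y `^ q + _]addrC; apply.
move=> _; rewrite le_eqVlt => /orP[/eqP <-|y0].
  by rewrite addr0 powR0 // mulr0 sqrtr0 mulr0 !addr0.
have x0 : 0 < x by apply: lt_le_trans yx.
set m := (ln x + ln y) / 2; set h := (ln x - ln y) / 2.
have h0 : 0 <= h by rewrite divr_ge0 // subr_ge0 ler_ln.
have xE : x = expR m * expR h.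
  by rewrite -expRD (_ : m + h = ln x) ?lnK ?posrE // /m /h; field.
have yE : y = expR m * expR (- h).
  by rewrite -expRD (_ : m - h = ln y) ?lnK ?posrE // /m /h; field.
have powE (a b : R) : (expR a) `^ b = expR (b * a) by rewrite /powR gt_eqF ?expR_gt0 // expRK.
rewrite xE yE -mulrDr !powRM ?expR_ge0 ?addr_ge0 ?expR_ge0 // !powE mulrN.
have -> : expR (q * m) * expR (q * h) * (expR (q * m) * expR (- (q * h))) = expR (q * m) ^+ 2.
  by rewrite expRN; field; rewrite gt_eqF ?expR_gt0.
rewrite sqrtr_sqr ger0_norm ?expR_ge0 //.
have := ler_wpM2l (expR_ge0 (q * m)) (powR_expRD_le q12 h0); lra.
Qed.

End PowerInequality.

Section Log2.
Variable R : realType.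

Lemma ln2_gt0 : 0 < ln 2 :> R.
Proof. by rewrite ln_gt0 //; lra. Qed.

Lemma powR_log2 (x : R) : 0 < x -> 2 `^ log2 x = x.
Proof.
by move=> x0; rewrite /powR gt_eqF // /log2 divfK ?gt_eqF ?ln2_gt0 // lnK.
Qed.

Lemma le_log2 (q x : R) : 0 < x -> (q <= log2 x) = (2 `^ q <= x).
Proof.
move=> x0; rewrite -{2}(powR_log2 x0) /powR !gt_eqF // ler_expR.
by rewrite ler_pM2r ?ln2_gt0.
Qed.

Lemma le_log2l (q x : R) : 0 < x -> (log2 x <= q) = (x <= 2 `^ q).
Proof.
move=> x0; rewrite -{2}(powR_log2 x0) /powR !gt_eqF // ler_expR.
by rewrite ler_pM2r ?ln2_gt0.
Qed.

Lemma log2_94_itv : 1 <= log2 (9 / 4 : R) <= 2.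
Proof.
have x0 : 0 < 9 / 4 :> R by lra.
rewrite le_log2 // le_log2l // powRr1 // (powR_mulrn 2) //; lra.
Qed.

Lemma log2_2 : log2 2 = 1 :> R.
Proof. by rewrite /log2 divff // gt_eqF // ln2_gt0. Qed.

End Log2.

Section PowerArrays.
Variables (R : realType) (I : finType).

Lemma powR_plucker_array (a : I -> I -> R) q : 1 <= q <= 2 ->
  (forall i j, a i j = a j i) -> (forall i, a i i = 0) ->
  (forall i j, i != j -> 0 < a i j) ->
  (forall i j k l, uniq [:: i; j; k; l] ->
     a i j * a k l <= a i k * a j l + a i l * a j k) ->
  plucker_array (2 `^ q - 2) (fun i j => a i j `^ q).
Proof.
move=> q12 aC a0 apos aplk; have q0 : 0 < q by lra.
split=> [i j|i|i j ij|i j k l u]; first by rewrite aC.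
- by rewrite a0 powR0 // gt_eqF.
- by apply/powR_gt0/apos.
have age0 i' j' : 0 <= a i' j'.
  by have [->|?] := eqVneq i' j'; [rewrite a0 | rewrite ltW ?apos].
have ge0 i' j' k' l' : 0 <= a i' j' * a k' l' by rewrite mulr_ge0.
have := powRD_le q12 (ge0 i k j l) (ge0 i l j k).
rewrite !(powRM _ (age0 _ _) (age0 _ _)); apply: le_trans; rewrite -powRM //.
by apply: ge0_ler_powR; rewrite ?nnegrE ?addr_ge0 // ?(ltW q0) // aplk.
Qed.

End PowerArrays.

(** * Ptolemaic metrics *)

Section MetricBound.
Variable R : realType.

Lemma big_option (T : finType) (F : option T -> R) :
  \sum_i F i = F None + \sum_x F (Some x).
Proof.
rewrite (bigD1 None) //=; congr (_ + _).
rewrite (reindex_omap Some id) /=; last by case.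
by apply: eq_bigl => x; rewrite eqxx.
Qed.

Lemma big_setT_option (T : finType) (F : option T -> R) :
  \sum_(i in setT) F i = F None + \sum_x F (Some x).
Proof. by rewrite -big_option; apply: eq_bigl => i; rewrite inE. Qed.

(* [None] is a point at infinity: the relations that involve it are the triangle
   inequalities, and its row encodes the constraint [\sum_x c x = 0]. *)
Definition add_infinity m (d : 'I_m -> 'I_m -> R) (i j : option 'I_m) : R :=
  match i, j with
  | Some x, Some y => d x y
  | None, None => 0
  | _, _ => 1
  end.

Lemma ptolemaic_negative_type m (c q : R) (d : 'I_m -> 'I_m -> R) :
  (2 < m <= 6)%N -> c * (m%:R - 3) <= 1 -> 0 <= c <= 1 ->
  1 <= q <= 2 -> 2 `^ q - 2 <= (3 * c - 1) / 2 ->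
  is_metric d -> ptolemaic d -> negative_type q d.
Proof.
move=> m6 cm c01 q12 qc [d0 deq dC dtri] ptol w w0.
have q0 : q != 0 by rewrite gt_eqF //; lra.
have PA : plucker_array (2 `^ q - 2) (fun i j => add_infinity d i j `^ q).
  apply: powR_plucker_array => //.
  - by case=> [x|] [y|] //=.
  - by case=> [x|] //=; apply/deq.
  - case=> [x|] [y|] //= xy; rewrite lt_neqAle d0 andbT eq_sym.
    by apply: contra xy => /eqP/deq ->.
  case=> [i|] [j|] [k|] [l|] //= _; rewrite ?mul1r ?mulr1 //.
  - by rewrite (dC j k).
  - by rewrite addrC (dC j l).
  - by rewrite mulr0 addr_ge0.
  - by rewrite (dC i k).
  - by rewrite mulr0 add0r.
  - by rewrite mulr0 addr0.
  - by rewrite addrC (dC j k).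
pose wo (i : option 'I_m) := if i is Some x then w x else 0.
have crossw : cross (fun i j => add_infinity d i j `^ q) setT wo None = 0.
  rewrite /cross big_setT_option.
  rewrite mul0r add0r -[RHS]w0; apply: eq_bigr => x _; by rewrite powR1 mulr1.
have m7 : (3 < #|{: option 'I_m}| <= 7)%N by rewrite card_option card_ord; lia.
have cm' : c * (#|{: option 'I_m}|%:R - 4) <= 1.
  by rewrite card_option card_ord -natr1; lra.
apply: le_trans (plucker_array_form_le0 PA c01 qc m7 cm' crossw).
rewrite le_eqVlt; apply/orP; left; apply/eqP.
rewrite /form big_setT_option [X in _ = X + _]big1 ?add0r => [|k _].
  apply: eq_bigr => x _; rewrite big_setT_option mulr0 mul0r add0r.
  by apply: eq_bigr.
by rewrite !mul0r.
Qed.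

(** * An explicit metric for the upper bounds *)

Lemma not_uniq_lt3 m (x y z w : 'I_m) :
  (x < 3)%N -> (y < 3)%N -> (z < 3)%N -> (w < 3)%N -> uniq [:: x; y; z; w] = false.
Proof.
move=> x3 y3 z3 w3; apply/negP; rewrite /= !inE !negb_or -!(inj_eq val_inj) /=.
lia.
Qed.

(* Extremal for 5 and for 6 points, and, as an array, for U_{2,6} and U_{2,7}. *)
Definition three_far m (x y : 'I_m) : R :=
  if x == y then 0 else if (x < 3)%N && (y < 3)%N then 2 else 1.

Lemma three_farxx m (x : 'I_m) : three_far x x = 0.
Proof. by rewrite /three_far eqxx. Qed.

Lemma three_farC m (x y : 'I_m) : three_far x y = three_far y x.
Proof. by rewrite /three_far eq_sym andbC. Qed.

Lemma three_far_itv m (x y : 'I_m) : x != y -> 1 <= three_far x y <= 2.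
Proof. by rewrite /three_far => /negPf ->; case: ifP => _; lra. Qed.

Lemma three_far_metric m : is_metric (@three_far m).
Proof.
split=> [x y|x y|x y|x y z].
- by rewrite /three_far; do 2?[case: ifP] => *; lra.
- rewrite /three_far; split=> [|->]; last by rewrite eqxx.
  by case: eqP => // _; case: ifP => _ /eqP; rewrite ?pnatr_eq0 ?oner_eq0.
- exact: three_farC.
- have [->|xy] := eqVneq x y; first by rewrite three_farxx add0r.
  have [->|yz] := eqVneq y z; first by rewrite three_farxx addr0.
  have := three_far_itv xy; have := three_far_itv yz.
  have [->|xz] := eqVneq x z; first by rewrite three_farxx; lra.
  have := three_far_itv xz; lra.
Qed.

(** The right side is at least 2, as all distances lie between 1 and 2. The left side exceeds 2 only
    if all four points are among the first three. *)
Lemma three_far_plucker m (x y z w : 'I_m) : uniq [:: x; y; z; w] ->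
  three_far x y * three_far z w <=
  three_far x z * three_far y w + three_far x w * three_far y z.
Proof.
move=> u; have /negPf hu : ~~ [&& (x < 3)%N, (y < 3)%N, (z < 3)%N & (w < 3)%N].
  by apply: contraL u => /and4P[? ? ? ?]; rewrite not_uniq_lt3.
uniq_hyps u.
have xz : 1 <= three_far x z <= 2 by apply: three_far_itv.
have yw : 1 <= three_far y w <= 2 by apply: three_far_itv.
have xw : 1 <= three_far x w <= 2 by apply: three_far_itv.
have yz : 1 <= three_far y z <= 2 by apply: three_far_itv.
have : three_far x y * three_far z w <= 2.
  rewrite /three_far; case: eqP => _; first by rewrite mul0r.
  case: eqP => _; first by rewrite mulr0.
  move: hu; case: (x < 3)%N; case: (y < 3)%N; case: (z < 3)%N; case: (w < 3)%N => //= _; lra.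
nra.
Qed.

Lemma three_far_ptolemaic m : ptolemaic (@three_far m).
Proof.
move=> x y z w.
have dge0 v v' : 0 <= three_far v v' := metric_ge0 (three_far_metric m) v v'.
have rhs_ge0 : 0 <= three_far x z * three_far y w + three_far x w * three_far y z.
  by rewrite addr_ge0 ?mulr_ge0.
have [->|xy] := eqVneq x y; first by rewrite three_farxx mul0r addr_ge0 ?mulr_ge0.
have [->|zw] := eqVneq z w; first by rewrite three_farxx mulr0 addr_ge0 ?mulr_ge0.
have [->|xz] := eqVneq x z.
  by rewrite three_farxx mul0r add0r mulrC (three_farC y z).
have [->|xw] := eqVneq x w.
  by rewrite three_farxx mul0r addr0 mulrC (three_farC w y) (three_farC z w) mulrC.
have [->|yz] := eqVneq y z; first by rewrite three_farxx mulr0 addr0.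
have [->|yw] := eqVneq y w.
  by rewrite three_farxx mulr0 add0r (three_farC z w).
by apply: three_far_plucker; uniq_goal.
Qed.

Lemma three_far_powR m (x y : 'I_m) (q : R) : 0 < q ->
  three_far x y `^ q =
  (x != y)%:R * (1 + (2 `^ q - 1) * ((x < 3)%N%:R * (y < 3)%N%:R)).
Proof.
move=> q0; rewrite /three_far; case: eqP => /= _; first by rewrite powR0 ?gt_eqF // mul0r.
by case: (x < 3)%N; case: (y < 3)%N => /=; rewrite ?powR1; ring.
Qed.

(** With [s] the indicator of the first three points, the matrix of q-th powers is J - I + (2^q - 1)
    (s s^T - diag s), where J is the all-ones matrix. *)
Lemma three_far_row m (w : 'I_m -> R) (q : R) (x : 'I_m) : 0 < q ->
  \sum_y w y * three_far x y `^ q = \sum_y w y - w x + (2 `^ q - 1) *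
    ((x < 3)%N%:R * (\sum_(y < m) (y < 3)%N%:R * w y - w x)).
Proof.
move=> q0; pose s (x : 'I_m) : R := (x < 3)%N%:R.
have ss : s x * s x = s x by rewrite /s; case: (_ < _)%N; rewrite ?mulr1 ?mulr0.
rewrite (bigD1 x) //= three_farxx powR0 ?gt_eqF // mulr0 add0r.
rewrite [\sum_y w y](bigD1 x) //= [\sum_(y < m) _](bigD1 x) //= -/(s x).
transitivity (\sum_(y | y != x) w y +
    (2 `^ q - 1) * (s x * \sum_(y | y != x) s y * w y)).
  rewrite !mulr_sumr -big_split /=; apply: eq_bigr => y yx.
  by rewrite three_far_powR // eq_sym yx mul1r /s; ring.
set S := \sum_(y | y != x) w y; set S' := \sum_(y | _) _ * _.
transitivity (S + (2 `^ q - 1) * (s x * S' + (s x * s x - s x) * w x)); last by ring.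
by rewrite ss; ring.
Qed.

Lemma three_far_form m (w : 'I_m -> R) (q : R) : 0 < q -> \sum_x w x = 0 ->
  \sum_x \sum_y w x * w y * three_far x y `^ q =
  (2 `^ q - 1) * ((\sum_(x < m) (x < 3)%N%:R * w x) ^+ 2
    - \sum_(x < m) (x < 3)%N%:R * w x ^+ 2)
  - \sum_x w x ^+ 2.
Proof.
move=> q0 w0.
transitivity (\sum_(x < m) ((2 `^ q - 1) *
    ((x < 3)%N%:R * w x * (\sum_(y < m) (y < 3)%N%:R * w y)
    - (x < 3)%N%:R * w x ^+ 2) - w x ^+ 2)).
  apply: eq_bigr => x _; rewrite (eq_bigr (fun y => w x * (w y * three_far x y `^ q))).
    by rewrite -mulr_sumr three_far_row // w0; ring.
  by move=> y _; rewrite mulrA.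
by rewrite sumrB -mulr_sumr sumrB -mulr_suml expr2.
Qed.

Lemma negative_type_three_far5 (q : R) :
  0 < q -> negative_type q (@three_far 5) -> 2 `^ q <= 9 / 4.
Proof.
(* Constant on the two classes and of sum zero; the form is [6 * (2 ^ q - 1) - 15 / 2]. *)
move=> q0 /(_ (fun x : 'I_5 => if (x < 3)%N then -1 else 3 / 2)).
have s0 : \sum_(x < 5) (if (x < 3)%N then -1 else 3 / 2) = 0 :> R.
  by rewrite !big_ord_recl big_ord0 /=; field.
move=> /(_ s0); rewrite three_far_form // !big_ord_recl !big_ord0 /=; lra.
Qed.

Lemma negative_type_three_far6 (q : R) :
  0 < q -> negative_type q (@three_far 6) -> 2 `^ q <= 2.
Proof.
move=> q0 /(_ (fun x : 'I_6 => if (x < 3)%N then -1 else 1)).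
have s0 : \sum_(x < 6) (if (x < 3)%N then -1 else 1) = 0 :> R.
  by rewrite !big_ord_recl big_ord0 /=; ring.
move=> /(_ s0); rewrite three_far_form // !big_ord_recl !big_ord0 /=; lra.
Qed.

Lemma ptolemaic_exponent_eq m (x : R) :
  1 < x -> (forall d : 'I_m -> 'I_m -> R,
    is_metric d -> ptolemaic d -> negative_type (log2 x) d) ->
  (forall q, 0 < q -> negative_type q (@three_far m) -> 2 `^ q <= x) ->
  ptolemaic_exponent R m = (log2 x)%:E.
Proof.
move=> x1 lower upper; have x0 : 0 < x by lra.
apply/eqP; rewrite eq_le; apply/andP; split.
  apply: ge_ereal_sup => _ [q [q0 hq] <-]; rewrite lee_fin le_log2 //.
  exact: (upper q q0 (hq _ (three_far_metric m) (@three_far_ptolemaic m))).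
apply: ereal_sup_ubound; exists (log2 x) => //; split => //.
by rewrite divr_gt0 ?ln2_gt0 // ln_gt0.
Qed.

Lemma ptolemaic_exponent5 : ptolemaic_exponent R 5 = (log2 (9 / 4))%:E.
Proof.
apply: ptolemaic_exponent_eq; [lra| |exact: negative_type_three_far5].
(* Both conditions on [c] hold with equality: [c * (5 - 3) = 1] and
   [(3 * c - 1) / 2 = 9 / 4 - 2]. *)
move=> d; apply: (@ptolemaic_negative_type _ (1 / 2)) => //; rewrite ?powR_log2; try lra.
exact: log2_94_itv.
Qed.

Lemma ptolemaic_exponent6 : ptolemaic_exponent R 6 = 1%:E.
Proof.
rewrite -log2_2; apply: ptolemaic_exponent_eq; [lra| |exact: negative_type_three_far6].
move=> d; rewrite log2_2.
by apply: (@ptolemaic_negative_type _ (1 / 3)) => //; rewrite ?powRr1; lra.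
Qed.

End MetricBound.

(** * Rank-two Lorentzian polynomials *)

Lemma char_poly_similar (F : fieldType) n (U A : 'M[F]_n) : U \in unitmx ->
  char_poly (invmx U *m A *m U) = char_poly A.
Proof.
move=> Uunit; pose V := map_mx polyC (invmx U); pose W := map_mx polyC U.
have VW : V *m W = 1%:M by rewrite -map_mxM mulVmx // map_mx1.
rewrite /char_poly; have -> : char_poly_mx (invmx U *m A *m U) = V *m char_poly_mx A *m W.
  rewrite /char_poly_mx mulmxBr mulmxBl -!map_mxM; congr (_ - _).
  by rewrite -mulmxA -scalar_mxC mulmxA VW mul1mx.
by rewrite !det_mulmx mulrAC -det_mulmx VW det1 mul1r.
Qed.

(** * Counting positive eigenvalues of a real symmetric matrix *)

Section RealSymmetric.
Import complex.
Local Open Scope sesquilinear_scope.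
Variables (R : realType) (n : nat) (A : 'M[R]_n).
Hypothesis A_sym : A^T = A.
Let C : numClosedFieldType := R[i].
Let AC : 'M[C]_n := map_mx (real_complex R) A.
Let U := spectralmx AC.
Let d i : C := spectral_diag AC 0 i.

Lemma real_symmetric_hermitian : AC \is hermsymmx.
Proof.
apply/is_hermitianmxP; rewrite expr0 scale1r; apply/matrixP => i j.
by rewrite !mxE -{1}A_sym mxE [RHS]conjc_real.
Qed.

Lemma spectral_decomposition : AC = invmx U *m diag_mx (spectral_diag AC) *m U.
Proof. exact/orthomx_spectralP/hermitian_normalmx/real_symmetric_hermitian. Qed.

Lemma spectral_real i : d i = (complex.Re (d i))%:C%C.
Proof.
have /mxOverP/(_ 0 i)/CrealP := hermitian_spectral_diag_real real_symmetric_hermitian.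
rewrite -/(d i); case: (d i) => a b /= [] /esym hb.
by congr (_ +i* _)%C; lra.
Qed.

(** The complexification is unitarily diagonalizable with real eigenvalues, so its factorization
    descends along the injection of [R] into [R[i]]. *)
Lemma real_symmetric_char_poly :
  char_poly A = \prod_(a <- [seq complex.Re (d i) | i <- enum 'I_n]) ('X - a%:P).
Proof.
apply: (map_poly_inj (real_complex R)).
rewrite map_char_poly -/AC spectral_decomposition char_poly_similar ?spectral_unit //.
rewrite char_poly_trig ?diag_mx_is_trig // big_map big_enum /= rmorph_prod.
apply: eq_bigr => i _; rewrite rmorphB /= map_polyX map_polyC /= -spectral_real.
by rewrite mxE eqxx mulr1n.
Qed.

Lemma spectral_row i : row i U *m AC = d i *: row i U.
Proof.
rewrite -row_mul [X in U *m X]spectral_decomposition !mulmxA mulmxV ?spectral_unit // mul1mx.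
by rewrite row_mul row_diag_mx -scalemxAl -rowE.
Qed.

(** Two positive eigenvalues would give a plane on which the form is positive definite, and every
    plane meets the hyperplane in a nonzero vector. *)
Lemma at_most_one_positive_of_hyperplane (z : 'I_n) :
  (forall w : 'I_n -> R, \sum_k w k * A z k = 0 ->
     \sum_k \sum_l w k * w l * A k l <= 0) ->
  at_most_one_positive_eigenvalue A.
Proof.
move=> Az; exists [seq complex.Re (d i) | i <- enum 'I_n].
  exact: real_symmetric_char_poly.
rewrite count_map enumT -size_filter.
have -> : size [seq x <- Finite.enum 'I_n |
      preim (fun i => complex.Re (d i)) (fun x => 0 < x) x] =
    #|[pred i | 0 < complex.Re (d i)]| by rewrite cardE.
rewrite leqNgt.
apply/negP => /card_gt1P[i [j [di dj ij]]].
rewrite !unfold_in /= in di dj.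
have uU := spectral_unitarymx AC.
have orth := row_unitarymxP uU.
(* a nonzero combination of the two eigenvectors on the hyperplane *)
have [a [b [ab0 abz]]] : exists a b : C, (a != 0) || (b != 0) /\
    a * (d i * U i z) + b * (d j * U j z) = 0.
  have [zi|zi] := eqVneq (d i * U i z) 0.
    by exists 1, 0; rewrite oner_eq0 zi mulr0 mul0r addr0.
  by exists (d j * U j z), (- (d i * U i z)); split;
    [rewrite oppr_eq0 zi orbT | ring].
pose w := a *: row i U + b *: row j U.
have wA : w *m AC = (a * d i) *: row i U + (b * d j) *: row j U.
  by rewrite mulmxDl -!scalemxAl !spectral_row !scalerA.
have wz : \sum_k w 0 k * AC z k = 0.
  transitivity ((w *m AC) 0 z).
    by rewrite mxE; apply: eq_bigr => k _; rewrite !mxE -{1}A_sym mxE.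
  by rewrite wA !mxE -!mulrA.
have hw : dotmx (w *m AC) w = a * a^* * d i + b * b^* * d j.
  rewrite wA /w !dotmxE !linearD /= !linearZ /= !map_mxD !map_mxZ.
  rewrite !mulmxDl !mulmxDr -!scalemxAl -!scalemxAr.
  have D (X Y : 'M[C]_1) : (X + Y) 0 0 = X 0 0 + Y 0 0 by rewrite mxE.
  have Z c (X : 'M[C]_1) : (c *: X) 0 0 = c * X 0 0 by rewrite mxE.
  have o i' j' : (row i' U *m (row j' U) ^t*) 0 0 = (i' == j')%:R by rewrite -dotmxE orth.
  by rewrite !(D, Z) !o !eqxx (negPf ij) eq_sym (negPf ij) /=; ring.
have Re_sqr (x : C) (r : R) :
    complex.Re (x * x^* * r%:C%C) = (complex.Re x ^+ 2 + complex.Im x ^+ 2) * r.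
  by case: x => x y /=; ring.
have sqr_ge (x : C) : 0 <= complex.Re x ^+ 2 + complex.Im x ^+ 2.
  by rewrite addr_ge0 ?sqr_ge0.
have sqr_gt (x : C) : x != 0 -> 0 < complex.Re x ^+ 2 + complex.Im x ^+ 2.
  move=> x0; rewrite lt_neqAle sqr_ge andbT eq_sym paddr_eq0 ?sqr_ge0 // !sqrf_eq0.
  by apply: contra x0; case: x => x y /= /andP[/eqP-> /eqP->].
have : 0 < complex.Re (dotmx (w *m AC) w).
  rewrite hw (spectral_real i) (spectral_real j) raddfD /= !Re_sqr.
  case/orP: ab0 => [/sqr_gt a0|/sqr_gt b0].
    by apply: ltr_pwDl; [exact: mulr_gt0 | apply: mulr_ge0; [exact: sqr_ge | exact: ltW]].
  by apply: ltr_wpDl; [apply: mulr_ge0; [exact: sqr_ge | exact: ltW] | exact: mulr_gt0].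
rewrite ltNge => /negP; apply.
clear wA hw; clearbody w.
have ACE k l : AC k l = (A k l)%:C%C by rewrite mxE.
have Asym k l : A k l = A l k by rewrite -{1}A_sym mxE.
(* As [A] is real, the real and imaginary parts of [w] both lie on the hyperplane, and the Hermitian
   value at [w] is the sum of the values of the form at them. *)
have re0 : \sum_k complex.Re (w 0 k) * A z k = 0.
  have := congr1 (@complex.Re R) wz; rewrite raddf_sum /=; apply: etrans.
  by apply: eq_bigr => k _; rewrite ACE; case: (w 0 k) => x y /=; ring.
have im0 : \sum_k complex.Im (w 0 k) * A z k = 0.
  have := congr1 (@complex.Im R) wz; rewrite raddf_sum /=; apply: etrans.
  by apply: eq_bigr => k _; rewrite ACE; case: (w 0 k) => x y /=; ring.
have := lerD (Az _ re0) (Az _ im0); rewrite addr0; apply: le_trans.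
rewrite le_eqVlt; apply/orP; left; apply/eqP.
rewrite dotmxE mxE raddf_sum exchange_big -big_split /=; apply: eq_bigr => l _.
rewrite !mxE mulr_suml raddf_sum -big_split /=; apply: eq_bigr => k _.
by rewrite ACE (Asym l k); case: (w 0 k) => x y; case: (w 0 l) => x' y' /=; ring.
Qed.

End RealSymmetric.

(** * Basis generating polynomials *)

Section BasesPoly.
Variables (R : realType) (n : nat).
Implicit Types (p : {set 'I_n} -> R) (M : matroid n).

Lemma mesym1_inj : injective (@mesym1 n).
Proof.
move=> A B AB; apply/setP => i; have := congr1 (fun m : multinom n => m i) AB.
by rewrite /mesym1 !mnmE; case: (i \in A); case: (i \in B).
Qed.

Lemma mcoeff_bases_poly M p a :
  mcoeff a (bases_poly M p) = \sum_(B in bases M) p B * (mesym1 B == a)%:R.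
Proof.
rewrite /bases_poly raddf_sum; apply: eq_bigr => B _ /=.
by rewrite mcoeffZ mcoeffX.
Qed.

Lemma mcoeff_bases_poly_mesym1 M p B : B \in bases M ->
  mcoeff (mesym1 B) (bases_poly M p) = p B.
Proof.
move=> BM; rewrite mcoeff_bases_poly (bigD1 B) //= eqxx mulr1 big1 ?addr0 // => A /andP[_ AB].
by rewrite (inj_eq mesym1_inj) (negPf AB) mulr0.
Qed.

Lemma bases_poly_supported M p : (forall B, (p B != 0) = (B \in bases M)) ->
  supported_on_bases M (bases_poly M p).
Proof.
move=> pM a; rewrite mcoeff_msupp; apply/idP/imageP => [|[B BM ->]]; last first.
  by rewrite mcoeff_bases_poly_mesym1 // pM.
rewrite mcoeff_bases_poly => a0.
have [B /andP[BM /eqP <-]|noB] := pickP (fun B => (B \in bases M) && (mesym1 B == a)).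
  by exists B.
case/eqP: a0; apply: big1 => B BM; have := noB B; rewrite BM /= => ->.
by rewrite mulr0.
Qed.

(** For squarefree exponents, M-convexity is basis exchange: a coordinate is larger in [a] exactly
    at an element of [A :\: B]. *)
Lemma bases_M_convex M (f : mpoly n R) : supported_on_bases M f ->
  M_convex (fun a => a \in msupp f).
Proof.
move=> fM a b; rewrite !fM => /imageP[A AM ->] /imageP[B BM ->] i.
rewrite /mesym1 !mnmE => iAB.
have iA : i \in A :\: B by rewrite inE; move: iAB; case: (i \in A); case: (i \in B).
have [y yBA yM] := bases_exchange AM BM iA.
move: yBA; rewrite inE => /andP[yA yB].
exists y; first by rewrite !mnmE yB (negPf yA).
rewrite fM; apply/imageP; exists (y |: A :\ i) => //.
apply/mnmP => x; rewrite !mnmE !inE (eq_sym i x) (eq_sym y x).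
move: iA; rewrite inE => /andP[_ iA].
have [->|xi] := eqVneq x i.
  have -> : (i == y) = false by apply: contraNF yA => /eqP <-.
  by rewrite iA.
have [->|xy] := eqVneq x y; first by rewrite (negPf yA).
by rewrite subn0 addn0.
Qed.

Definition pairing p : 'M[R]_n := \matrix_(i, j) (if i == j then 0 else p [set i; j]).

Lemma mesym1_pair (i j : 'I_n) : i != j -> mesym1 [set i; j] = mnm_add (mnm1 j) (mnm1 i).
Proof.
move=> ij; apply/mnmP => x; rewrite !mnmE !inE (eq_sym i) (eq_sym j).
have [->|_] := eqVneq x i; have [xj|_] := eqVneq _ j => //.
by rewrite xj eqxx in ij.
Qed.

Lemma uniform2_bases B : (1 < n)%N -> (B \in bases (uniform 2 n)) = (#|B| == 2%N).
Proof. by move=> n1; rewrite inE (minn_idPl n1). Qed.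

Lemma hessian_bases_poly p : (1 < n)%N ->
  hessian (bases_poly (uniform 2 n) p) = pairing p.
Proof.
move=> n1; apply/matrixP => i j; rewrite !mxE !mcoeff_mderiv !mnmE.
have -> : mnm_add (mnm_add mnm0 (mnm1 i)) (mnm1 j) = mnm_add (mnm1 i) (mnm1 j).
  by apply/mnmP => x; rewrite !mnmE.
have [->|ij] := eqVneq i j; last first.
  rewrite -mesym1_pair 1?eq_sym // mcoeff_bases_poly_mesym1.
    by rewrite !mulr1n finset.setUC.
  by rewrite uniform2_bases // cards2 (eq_sym j) ij.
(* On the diagonal the coefficient of a square is read off, and all monomials are squarefree. *)
rewrite mcoeff_bases_poly big1 ?mul0rn // => B _.
have [Bj|] := eqVneq; rewrite ?mulr0 //.
have := congr1 (fun m : multinom n => m j) Bj; rewrite /mesym1 !mnmE eqxx.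
by case: (j \in B).
Qed.

End BasesPoly.

(** * Thresholds of rank-two uniform matroids *)

Section LorentzianThreshold.
Variables (R : realType) (n : nat).
Implicit Types (p : {set 'I_n} -> R) (q : R).

Lemma matroid_rank_uniform r : (r <= n)%N -> matroid_rank (uniform r n) = r.
Proof.
move=> rn; have [B BM] := uniform_bases_nonempty r n.
apply/eqP; rewrite eqn_leq; apply/andP; split.
  by apply/bigmax_leqP => A; rewrite inE (minn_idPl rn) => /eqP ->.
have cB : #|B| = r by move: BM; rewrite inE (minn_idPl rn) => /eqP.
by rewrite -{1}cB /matroid_rank (bigD1 B) //= leq_maxl.
Qed.

Lemma weak_rep_pairing_gt0 q p i j : (1 < n)%N ->
  weak_representation q (uniform 2 n) p -> i != j -> 0 < p [set i; j].
Proof.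
move=> n1 [p0 psupp _] ij; rewrite lt_neqAle p0 andbT eq_sym psupp.
by rewrite uniform2_bases // cards2 ij.
Qed.

(** In rank two the set [S] of a three-term relation is empty, and the first inequality of [T_null]
    is Ptolemy's inequality for the q-th roots [a]. *)
Lemma weak_rep_plucker_array q p : (1 < n)%N -> 1 <= q <= 2 ->
  weak_representation q (uniform 2 n) p ->
  plucker_array (2 `^ q - 2) (fun i j => pairing p i j).
Proof.
move=> n1 q12 hp; have q0 : 0 < q by lra.
have pE i j : i != j -> pairing p i j = p [set i; j] by rewrite mxE => /negPf ->.
have pge0 i j : 0 <= pairing p i j.
  by rewrite mxE; case: eqP => // _; exact: (weak_rep_ge0 hp).
pose a i j := pairing p i j `^ q^-1.
have aK i j : pairing p i j = a i j `^ q.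
  by rewrite /a -powRrM mulVf ?gt_eqF // powRr1.
suff PA : plucker_array (2 `^ q - 2) (fun i j => a i j `^ q).
  split=> [i j|i|i j|i j k l]; rewrite !aK.
  - exact: (array_sym PA).
  - exact: (array_diag PA).
  - exact: (array_gt0 PA).
  - exact: (array_plucker PA).
apply: powR_plucker_array => //.
- by move=> i j; rewrite /a !mxE eq_sym finset.setUC.
- by move=> i; rewrite /a mxE eqxx powR0 // invr_eq0 gt_eqF.
- by move=> i j ij; apply: powR_gt0; rewrite pE //; exact: weak_rep_pairing_gt0 hp ij.
move=> i j k l u; uniq_hyps u.
have := @weak_rep_plucker _ _ _ _ _ hp finset.set0 i j k l.
rewrite cards0 matroid_rank_uniform // => /(_ erefl u).
have -> : [disjoint (finset.set0 : {set 'I_n}) & [:: i; j; k; l]].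
  by apply/pred0P => x /=; rewrite !inE.
rewrite !finset.setU0 => /(_ isT)[h _ _]; move: h.
by rewrite !powRM ?(weak_rep_ge0 hp) // /a !pE.
Qed.

Lemma bases_poly_lorentzian p : (1 < n)%N ->
  (forall B, 0 <= p B) -> (forall B, (p B != 0) = (B \in bases (uniform 2 n))) ->
  at_most_one_positive_eigenvalue (pairing p) ->
  lorentzian (bases_poly (uniform 2 n) p).
Proof.
move=> n1 p0 psupp eig; have supp := bases_poly_supported psupp.
exists 2%N; split.
- move=> a; rewrite supp => /imageP[B BM ->].
  by rewrite mdeg_mesym1; apply/eqP; rewrite -uniform2_bases.
- by move=> a; rewrite mcoeff_bases_poly sumr_ge0 // => B _; rewrite mulr_ge0 // ler0n.
- exact: bases_M_convex supp.
move=> a [] /eqP; rewrite mdeg_eq0 => /eqP ->.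
by rewrite mderivm0m hessian_bases_poly.
Qed.

Lemma Gr_weak_sub_PL q c : (1 < n)%N -> (3 < n <= 7)%N -> 1 <= q <= 2 ->
  0 <= c <= 1 -> 2 `^ q - 2 <= (3 * c - 1) / 2 -> c * (n%:R - 4) <= 1 ->
  classical_sets.subset (Gr_weak (R := R) q (uniform 2 n)) (PL (uniform 2 n)).
Proof.
move=> n1 n7 q12 c01 qc cn _ [p hp <-]; exists (bases_poly (uniform 2 n) p) => //.
split; last exact/bases_poly_supported/(weak_rep_support hp).
apply: bases_poly_lorentzian => //; [exact: weak_rep_ge0 hp | exact: weak_rep_support hp |].
have PA := weak_rep_plucker_array n1 q12 hp.
have z : 'I_n by exists 0%N; lia.
apply: (@at_most_one_positive_of_hyperplane _ _ _ _ z).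
  by apply/matrixP => i j; rewrite mxE; exact: (array_sym PA).
move=> w wz.
have n7' : (3 < #|'I_n| <= 7)%N by rewrite card_ord.
have cn' : c * (#|'I_n|%:R - 4) <= 1 by rewrite card_ord.
have sumT (F : 'I_n -> R) : \sum_(i in [set: 'I_n]) F i = \sum_i F i.
  by apply: eq_bigl => i; rewrite inE.
have := @plucker_array_form_le0 _ _ _ _ _ PA c01 qc z w n7' cn'.
rewrite /cross /form !sumT => /(_ wz); apply: le_trans.
by rewrite le_eqVlt; apply/orP; left; apply/eqP/eq_bigr => k _; rewrite sumT.
Qed.

Lemma two_positive_eigenvalues (A : 'M[R]_n) a b :
  at_most_one_positive_eigenvalue A -> 0 < a -> 0 < b -> a != b ->
  eigenvalue A a -> eigenvalue A b -> False.
Proof.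
move=> [s As cs] a0 b0 ab ea eb; move: cs; rewrite leqNgt => /negP; apply.
have ins x : eigenvalue A x -> x \in s.
  by rewrite eigenvalue_root_char As root_prod_XsubC.
rewrite -size_filter; have : uniq [:: a; b] by rewrite /= inE ab.
move/uniq_leq_size; apply=> x; rewrite !inE mem_filter => /orP[] /eqP ->.
- by rewrite a0 ins.
- by rewrite b0 ins.
Qed.

Lemma positive_roots (T D : R) : 0 < T -> 0 < D -> 4 * D < T ^+ 2 ->
  exists x y, [/\ 0 < x, 0 < y, x != y, x ^+ 2 - T * x + D = 0 & y ^+ 2 - T * y + D = 0].
Proof.
move=> T0 D0 DT; set r := Num.sqrt (T ^+ 2 - 4 * D).
have disc0 : 0 < T ^+ 2 - 4 * D by lra.
have r0 : 0 < r by rewrite sqrtr_gt0.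
have r2 : r ^+ 2 = T ^+ 2 - 4 * D by rewrite sqr_sqrtr // ltW.
have rT : r < T by rewrite -(@ltr_pXn2r _ 2) ?nnegrE ?ltW // r2; lra.
have DE : D = (T ^+ 2 - r ^+ 2) / 4 by lra.
exists ((T + r) / 2), ((T - r) / 2).
by split; rewrite ?gt_eqF ?DE; first [lra | field].
Qed.

Definition three_far_rep (t : R) (B : {set 'I_n}) : R :=
  if #|B| == 2%N then if B \subset [set x : 'I_n | (x < 3)%N] then t else 1 else 0.

Lemma three_far_repE q (i j : 'I_n) : i != j ->
  three_far_rep (2 `^ q) [set i; j] = three_far R i j `^ q.
Proof.
move=> ij; rewrite /three_far_rep cards2 ij eqxx finset.subUset !sub1set !inE.
by rewrite /three_far (negPf ij); case: ifP => _ //; rewrite powR1.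
Qed.

Lemma three_far_weak_rep q : (1 < n)%N -> 0 < q ->
  weak_representation q (uniform 2 n) (three_far_rep (2 `^ q)).
Proof.
move=> n1 q0; have t0 : 0 < 2 `^ q :> R by rewrite powR_gt0.
split=> [B|B|S i j k l cS u _].
- by rewrite /three_far_rep; do 2?[case: ifP] => //; rewrite ltW.
- rewrite uniform2_bases // /three_far_rep; have [_|_] := eqVneq #|B| 2; last by rewrite eqxx.
  by case: ifP => _; rewrite gt_eqF.
have S0 : S = finset.set0.
  by move: cS; rewrite matroid_rank_uniform // => -[] /eqP; rewrite cards_eq0 => /eqP.
have rep (i' j' : 'I_n) : i' != j' ->
    three_far_rep (2 `^ q) (i' |: (j' |: S)) = three_far R i' j' `^ q.
  by move=> ij; rewrite S0 finset.setU0 three_far_repE.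
have dge0 (x y : 'I_n) : 0 <= three_far R x y := metric_ge0 (three_far_metric R n) x y.
have rt (i' j' k' l' : 'I_n) : i' != j' -> k' != l' ->
    (three_far_rep (2 `^ q) (i' |: (j' |: S)) * three_far_rep (2 `^ q) (k' |: (l' |: S)))
      `^ q^-1 = three_far R i' j' * three_far R k' l'.
  move=> ij kl; rewrite !rep // -powRM // -powRrM mulfV ?gt_eqF // powRr1 //.
  by rewrite mulr_ge0.
uniq_hyps u; rewrite /T_null !rt //.
have tfC := @three_farC R n.
split.
- exact: three_far_plucker.
- have := @three_far_plucker R n i k j l ltac:(uniq_goal).
  by rewrite (tfC k j).
- have := @three_far_plucker R n i l k j ltac:(uniq_goal).
  rewrite (tfC l k) (tfC l j) (tfC k j); lra.
Qed.

(** The first three points and the others form an equitable partition with quotient matrix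
    [[2t, n - 3], [3, n - 4]], whose characteristic polynomial is the quadratic in [hx]. The
    eigenvector is [n - 3] on the first class and [x - 2 * t] on the second. The factor [c] accounts
    for the choice of a polynomial on the ray. *)
Lemma three_far_eigenvalue (c t x : R) q : (3 < n)%N -> 0 < q -> t = 2 `^ q ->
  x ^+ 2 - (2 * t + (n%:R - 4)) * x + (2 * t * (n%:R - 4) - 3 * (n%:R - 3)) = 0 ->
  eigenvalue (c *: pairing (three_far_rep t)) (c * x).
Proof.
move=> n3 q0 tE hx.
have sum3 : \sum_(y < n) (y < 3)%N%:R = 3 :> R.
  have := @big_ord_widen R 0 +%R 3 n (fun=> 1) (ltnW n3).
  rewrite sumr_const card_ord => ->; rewrite [RHS]big_mkcond; apply: eq_bigr => y _.
  by case: (_ < _)%N.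
pose v (y : 'I_n) : R := (x - 2 * t) + (n%:R - 3 + 2 * t - x) * (y < 3)%N%:R.
have sumv : \sum_y v y = n%:R * (x - 2 * t) + 3 * (n%:R - 3 + 2 * t - x).
  by rewrite big_split /= sumr_const card_ord -mulr_sumr sum3 mulr_natl; congr (_ + _); ring.
have sumv3 : \sum_(y < n) (y < 3)%N%:R * v y = 3 * (n%:R - 3).
  transitivity (\sum_(y < n) (y < 3)%N%:R * (n%:R - 3) : R); last first.
    by rewrite -mulr_suml sum3.
  by apply: eq_bigr => y _; rewrite /v; case: (_ < _)%N; rewrite ?mul1r ?mulr1 ?mul0r //; ring.
apply/eigenvalueP; exists (\row_y v y).
  apply/rowP => y; rewrite !mxE.
  transitivity (c * \sum_k v k * three_far R y k `^ q).
    rewrite mulr_sumr; apply: eq_bigr => k _; rewrite !mxE.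
    have [->|ky] := eqVneq k y.
      by rewrite three_farxx powR0 ?gt_eqF // !mulr0.
    by rewrite tE three_far_repE // three_farC; ring.
  rewrite three_far_row // sumv sumv3 -tE /v.
  rewrite -mulrA; congr (c * _); case: (y < 3)%N; rewrite ?(mul1r, mulr1, mul0r, mulr0).
    ring.
  apply/eqP; rewrite eq_sym -subr_eq0 -[X in _ == X]hx; apply/eqP; ring.
apply/eqP => /rowP/(_ (Ordinal (ltnW (ltnW (ltnW n3))))); rewrite !mxE /v /= => /eqP.
have -> : x - 2 * t + (n%:R - 3 + 2 * t - x) * true%:R = n%:R - 3 by rewrite mulr1; ring.
by rewrite subr_eq0 eqr_nat gtn_eqF.
Qed.

(** If the inequality fails, the quotient matrix has positive trace, determinant and discriminant,
    hence two distinct positive eigenvalues. *)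
Lemma three_far_not_PL q : (3 < n)%N -> 0 < q ->
  classical_sets.subset (Gr_weak (R := R) q (uniform 2 n)) (PL (uniform 2 n)) ->
  2 * 2 `^ q * (n%:R - 4) <= 3 * (n%:R - 3) :> R.
Proof.
move=> n3 q0 sub; rewrite leNgt; apply/negP => lt_t; set t : R := 2 `^ q in lt_t.
have n1 : (1 < n)%N by lia.
have t0 : 0 < t by rewrite powR_gt0.
pose p := three_far_rep t; have hp := three_far_weak_rep n1 q0.
have [|f [[deg [fdeg _ _ feig]] fsupp] rayf] := sub (ray (bases_poly (uniform 2 n) p)).
  by exists p.
(* Equality of the rays makes the Lorentzian [f] a positive multiple of the basis polynomial. *)
have [c c0 fE] : ray (bases_poly (uniform 2 n) p) f.
  by rewrite -rayf; exists 1; rewrite ?scale1r //= ltr01.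
have deg2 : deg = 2%N.
  have [B BM] := bases_nonempty (uniform 2 n).
  rewrite -(fdeg (mesym1 B)) ?mdeg_mesym1; last by rewrite fsupp; apply/imageP; exists B.
  by apply/eqP; rewrite -uniform2_bases.
have := feig (mnm0); rewrite mdeg0 deg2 mderivm0m => /(_ erefl).
have -> : hessian f = c *: pairing p.
  rewrite -hessian_bases_poly // -fE; apply/matrixP => i j.
  by rewrite !mxE !mderivZ mcoeffZ.
have n4 : 4 <= n%:R :> R by rewrite (ler_nat _ 4).
have [||| x [y [x0 y0 xy hx hy]]] := @positive_roots (2 * t + (n%:R - 4))
    (2 * t * (n%:R - 4) - 3 * (n%:R - 3)).
- lra.
- lra.
- rewrite -subr_gt0; have -> : (2 * t + (n%:R - 4)) ^+ 2
      - 4 * (2 * t * (n%:R - 4) - 3 * (n%:R - 3))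
    = (2 * t - (n%:R - 4)) ^+ 2 + 12 * (n%:R - 3) by ring.
  by rewrite ltr_wpDl ?sqr_ge0 //; lra.
move=> /two_positive_eigenvalues/(_ (mulr_gt0 c0 x0) (mulr_gt0 c0 y0)); apply.
- by rewrite (inj_eq (mulfI (lt0r_neq0 c0))).
- exact: (three_far_eigenvalue c n3 q0 (erefl t) hx).
- exact: (three_far_eigenvalue c n3 q0 (erefl t) hy).
Qed.

Lemma uniform_threshold_eq (c x : R) : (3 < n <= 7)%N -> 2 <= x <= 4 ->
  0 <= c <= 1 -> x - 2 <= (3 * c - 1) / 2 -> c * (n%:R - 4) <= 1 ->
  2 * x * (n%:R - 4) = 3 * (n%:R - 3) ->
  uniform_threshold R n = (log2 x)%:E.
Proof.
move=> n7 x24 c01 cx cn xn; have n3 : (3 < n)%N by lia.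
have n1 : (1 < n)%N by lia.
have x0 : 0 < x by lra.
have q12 : 1 <= log2 x <= 2.
  by rewrite le_log2 // le_log2l // powRr1 // (powR_mulrn 2) //; lra.
apply/eqP; rewrite eq_le; apply/andP; split.
  apply: ge_ereal_sup => _ [q [q0 hq] <-]; rewrite lee_fin le_log2 //.
  have := three_far_not_PL n3 q0 hq; rewrite -xn.
  (* At [n = 4] the equation for [x] would read 0 = 3. *)
  have n4 : 0 < n%:R - 4 :> R.
    have : 4 <= n%:R :> R by rewrite (ler_nat _ 4).
    rewrite le_eqVlt => /orP[/eqP nE|]; last by rewrite subr_gt0.
    by move: xn; rewrite -nE; lra.
  by rewrite ler_pM2r // ler_pM2l.
apply: ereal_sup_ubound; exists (log2 x) => //; split; first by lra.
by apply: (Gr_weak_sub_PL n1 n7 q12 c01 _ cn); rewrite powR_log2.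
Qed.

End LorentzianThreshold.

Lemma uniform_threshold6 (R : realType) : uniform_threshold R 6 = (log2 (9 / 4))%:E.
Proof. by apply: (@uniform_threshold_eq _ _ (1 / 2)) => //; lra. Qed.

Lemma uniform_threshold7 (R : realType) : uniform_threshold R 7 = 1%:E.
Proof. by rewrite -log2_2; apply: (@uniform_threshold_eq _ _ (1 / 3)) => //; lra. Qed.

Theorem theorem1p1 (R : realType) :
  [/\ ptolemaic_exponent R 5 = (log2 (9 / 4))%:E /\ ptolemaic_exponent R 6 = 1%:E,
      uniform_threshold R 6 = (log2 (9 / 4))%:E /\ uniform_threshold R 7 = 1%:E
    & forall n : nat, n = 6%N \/ n = 7%N ->
        uniform_threshold R n =
          (if odd n then log2 ((n%:R + 1) / (n%:R - 3))
           else 2 * log2 (n%:R / (n%:R - 2)))%:E].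
Proof.
split.
- by rewrite ptolemaic_exponent5 ptolemaic_exponent6.
- by rewrite uniform_threshold6 uniform_threshold7.
move=> n [->|->] /=.
  rewrite uniform_threshold6 /log2 mulrA; congr (_ / _)%:E.
  (* The factor 2 of the even case comes from 9/4 being the square of 6/4. *)
  have -> : 9 / 4 = (6 / (6 - 2)) ^+ 2 :> R by field.
  by rewrite lnXn ?mulr_natl //; lra.
rewrite uniform_threshold7 -[1 in LHS]log2_2; congr (log2 _)%:E.
have -> : 7%:R - 3 = 4 :> R by ring.
by field.
Qed.
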